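(* Let $\mathcal{A}$ be a finite alphabet and let $\varphi\colon\mathcal{A}\to\mathcal{A}^*$ be a primitive substitution of constant length $k\geq 2$, with associated subshift $(X_\varphi,T)$. Then the following are equivalent: (i) $\mathrm{ac}(X_{\varphi})\in\{0,1\}$; (ii) $X_{\varphi}$ is null; (iii) $X_{\varphi}$ is tame. Moreover, in (i), the value $\mathrm{ac}(X_\varphi)=0$ corresponds to $X_\varphi$ being finite, i.e. $\mathrm{ac}(X_\varphi)=0$ if and only if $X_\varphi$ is finite.
   Context: Substitutions. $\mathcal{A}^*$ is the set of finite words over the finite set $\mathcal{A}$. A substitution is a map $\varphi\colon\mathcal{A}\to\mathcal{A}^*$, extended to $\mathcal{A}^*$ by concatenation. It has (constant) length $k$ if $|\varphi(a)|=k$ for all $a\in\mathcal{A}$; it is primitive if for some $n\geq 1$ every word $\varphi^n(a)$, $a\in\mathcal{A}$, contains every letter of $\mathcal{A}$. The subshift $X_\varphi\subseteq\mathcal{A}^{\mathbf Z}$ is the set of all $x\in\mathcal{A}^{\mathbf Z}$ such that each finite word appearing in $x$ appears in $\varphi^n(a)$ for some $a\in\mathcal{A}$, $n\geq 0$. $T$ is the left shift, $(Tx)_n=x_{n+1}$; $\mathcal A^{\mathbf Z}$ carries the product topology, metrized by $d(x,y)=\beta^{-j}$, $j=\min\{|\ell| : x_\ell\neq y_\ell\}$, for a fixed $\beta>1$ ($d(x,x)=0$). Tameness and nullness. Let $f\colon X\to X$ be a homeomorphism of a compact metric space $(X,d)$. A set $S\subset\mathbf{Z}$ is an independence set for a pair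 $(U_0,U_1)$ of subsets of $X$ if for every finite $G\subset S$ and every $\sigma\colon G\to\{0,1\}$ one has $\bigcap_{i\in G}f^{-i}U_{\sigma(i)}\neq\emptyset$. A pair $(x_0,x_1)\in X\times X$ is an IT pair (resp. IN pair) if for every neighbourhood $U_0\times U_1$ of $(x_0,x_1)$ the pair $(U_0,U_1)$ has an infinite independence set (resp. arbitrarily large finite independence sets). $(X,f)$ is tame (resp. null) if it has no IT pair (resp. no IN pair) with $x_0\neq x_1$. Amorphic complexity. For $\delta>0$, $\nu\in(0,1]$, points $x,y\in X$ are $(f,\delta,\nu)$-separated if the set $E=\{\ell\in\mathbf{Z} : d(f^\ell(x),f^\ell(y))\geq\delta\}$ has upper density $\limsup_{n\to\infty}\frac{|E\cap[-n,n]|}{2n+1}\geq\nu$. Let $\mathrm{Sep}(f,\delta,\nu)\in\mathbf{N}\cup\{\infty\}$ be the supremum of the cardinalities of subsets of $X$ all of whose pairs of distinct points are $(f,\delta,\nu)$-separated. The lower and upper amorphic complexity are $\underline{\mathrm{ac}}(f)=\sup_{\delta>0}\liminf_{\nu\to 0}\frac{\log\mathrm{Sep}(f,\delta,\nu)}{-\log\nu}$ and $\overline{\mathrm{ac}}(f)=\sup_{\delta>0}\limsup_{\nu\to 0}\frac{\log\mathrm{Sep}(f,\delta,\nu)}{-\log\nu}$, with values in $[0,\infty]$ (and both are $\infty$ if some separation number is infinite). If they coincide, the common value is the amorphic complexity. $\mathrm{ac}(X_\varphi)$ denotes this value for $f=T|_{X_\varphi}$; a statement ''$\mathrm{ac}(X_\varphi)=c$''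 means that both $\underline{\mathrm{ac}}$ and $\overline{\mathrm{ac}}$ equal $c$. *)

(* Defs.v *)
From HB Require Import structures.
From mathcomp Require Import all_boot all_order all_algebra finmap.
From mathcomp Require Import all_classical all_reals all_analysis.

Set Implicit Arguments.
Unset Strict Implicit.
Unset Printing Implicit Defensive.

Import Order.TTheory GRing.Theory Num.Theory.
Import numFieldNormedType.Exports.

Local Open Scope classical_set_scope.
Local Open Scope ring_scope.

Definition subst_ext (A : finType) (phi : A -> seq A) (w : seq A) : seq A :=
  flatten (map phi w).

Definition subst_iter (A : finType) (phi : A -> seq A) (n : nat) (a : A) :
  seq A := iter n (subst_ext phi) [:: a].

Definition constant_length (A : finType) (phi : A -> seq A) (k : nat) : Prop :=
  forall a, size (phi a) = k.

Definition primitive (A : finType) (phi : A -> seq A) : Prop :=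
  exists2 n, (1 <= n)%N & forall a b, b \in subst_iter phi n a.

(* The topology is the product of the discrete ones. *)
Definition full_shift (A : finType) : topologicalType :=
  {ptws int -> discrete_topology A}.

Definition left_shift (A : finType) (x : full_shift A) : full_shift A :=
  fun n : int => x (n + 1).

Definition left_shift_inv (A : finType) (x : full_shift A) : full_shift A :=
  fun n : int => x (n - 1).

Lemma left_shiftK (A : finType) : cancel (@left_shift A) (@left_shift_inv A).
Proof.
move=> x; apply/funext => n.
by rewrite /left_shift /left_shift_inv subrK.
Qed.

Lemma left_shift_invK (A : finType) :
  cancel (@left_shift_inv A) (@left_shift A).
Proof.
move=> x; apply/funext => n.
by rewrite /left_shift /left_shift_inv addrK.
Qed.

Definition appears_in (A : finType) (w : seq A) (x : full_shift A) : Prop :=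
  exists i : int, w = mkseq (fun j => x (i + j%:Z)) (size w).

Definition subshift (A : finType) (phi : A -> seq A) : set (full_shift A) :=
  [set x | forall w, appears_in w x ->
     exists a n, infix w (subst_iter phi n a)].

Lemma subshift_shift (A : finType) (phi : A -> seq A) (x : full_shift A) :
  subshift phi (left_shift x) <-> subshift phi x.
Proof.
split=> h w [i wE]; apply: h.
  exists (i - 1); rewrite [LHS]wE; apply: eq_mkseq => j.
  by rewrite /left_shift -addrA [_ + 1]addrC addrA subrK.
exists (i + 1); rewrite [LHS]wE; apply: eq_mkseq => j.
by rewrite /left_shift -!addrA [1 + _]addrC.
Qed.

Definition differ_at (A : finType) (x y : full_shift A) (j : nat) : bool :=
  ((x j%:Z : A) != y j%:Z) || ((x (- j%:Z) : A) != y (- j%:Z)).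

(* beta^-j with j the least |l| such that x l != y l; the second branch is the
   case x = y. *)
Definition shift_dist (R : realType) (beta : R) (A : finType)
    (x y : full_shift A) : R :=
  match pselect (exists j, differ_at x y j) with
  | left ex => beta ^- ex_minn ex
  | right _ => 0
  end.

Lemma shift_dist_eq0 (R : realType) (beta : R) (A : finType)
    (x y : full_shift A) :
  1 < beta -> (shift_dist beta x y = 0) <-> x = y.
Proof.
move=> beta1; rewrite /shift_dist; case: pselect => [ex|nex]; split => //.
- move=> /eqP; rewrite invr_eq0 expf_eq0 gt_eqF ?andbF//.
  exact: lt_trans beta1.
- by move=> xy; exfalso; case: ex => j; rewrite /differ_at xy !eqxx.
- move=> _; apply/funext => l; apply: contrapT => /eqP neq.
  by apply: nex; exists `|l|%N; rewrite /differ_at; case: l neq => n neq;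
    rewrite ?NegzE ?abszN /= ?neq ?orbT // -NegzE neq orbT.
Qed.

(* In what follows a homeomorphism f comes with its inverse g, and the dynamical
   system is the restriction of f to an invariant subset X of the ambient space
   E. Neighbourhoods are taken in E: as independence is tested on points of X,
   only their traces on X matter. *)

Definition zpow (E : Type) (f g : E -> E) (l : int) : E -> E :=
  match l with
  | Posz n => iter n f
  | Negz n => iter n.+1 g
  end.

Definition independence_set (E : Type) (X : set E) (f g : E -> E)
    (U0 U1 : set E) (S : set int) : Prop :=
  forall (G : set int) (s : int -> bool), finite_set G -> G `<=` S ->
    X `&` \bigcap_(i in G) (zpow f g i @^-1` (if s i then U1 else U0))
      !=set0.

Definition IT_pair (E : topologicalType) (X : set E) (f g : E -> E)
    (x0 x1 : E) : Prop :=
  [/\ X x0, X x1 & forall U0 U1, nbhs x0 U0 -> nbhs x1 U1 ->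
    exists2 S : set int,
      infinite_set S & independence_set X f g U0 U1 S].

Definition IN_pair (E : topologicalType) (X : set E) (f g : E -> E)
    (x0 x1 : E) : Prop :=
  [/\ X x0, X x1 & forall U0 U1, nbhs x0 U0 -> nbhs x1 U1 ->
    forall n, exists2 S : {fset int},
      (n <= #|` S|)%N & independence_set X f g U0 U1 [set` S]].

Definition tame (E : topologicalType) (X : set E) (f g : E -> E) : Prop :=
  forall x0 x1, IT_pair X f g x0 x1 -> x0 = x1.

Definition null (E : topologicalType) (X : set E) (f g : E -> E) : Prop :=
  forall x0 x1, IN_pair X f g x0 x1 -> x0 = x1.

Local Open Scope ereal_scope.

Definition upper_density (R : realType) (D : set int) : \bar R :=
  limn_esup (fun n : nat =>
    counting (D `&` [set l : int | (`|l| <= n%:Z)%R])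
      * ((2 * n + 1)%N%:R^-1)%:E).

Definition ac_separated (R : realType) (E : choiceType) (d : E -> E -> R)
    (f g : E -> E) (delta nu : R) (x y : E) : Prop :=
  nu%:E <= upper_density R
    [set l : int | (delta <= d (zpow f g l x) (zpow f g l y))%R].

(* counting is the cardinality, with value +oo on infinite sets *)
Definition Sep (R : realType) (E : choiceType) (d : E -> E -> R)
    (X : set E) (f g : E -> E) (delta nu : R) : \bar R :=
  ereal_sup [set counting Z | Z in [set Z : set E | Z `<=` X /\
    forall x y, Z x -> Z y -> x <> y -> ac_separated d f g delta nu x y]].

(* er_map ln sends +oo to +oo; since ln 0 = 0, an empty X gets complexity 0. *)
Definition ac_ratio (R : realType) (E : choiceType) (d : E -> E -> R)
    (X : set E) (f g : E -> E) (delta nu : R) : \bar R :=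
  er_map (@ln R) (Sep d X f g delta nu) * ((- ln nu)^-1)%:E.

Definition lower_ac (R : realType) (E : choiceType) (d : E -> E -> R)
    (X : set E) (f g : E -> E) : \bar R :=
  ereal_sup [set limf_einf (ac_ratio d X f g delta) (0%R : R)^'+
    | delta in [set delta : R | (0 < delta)%R]].

Definition upper_ac (R : realType) (E : choiceType) (d : E -> E -> R)
    (X : set E) (f g : E -> E) : \bar R :=
  ereal_sup [set limf_esup (ac_ratio d X f g delta) (0%R : R)^'+
    | delta in [set delta : R | (0 < delta)%R]].

Definition ac_eq (R : realType) (E : choiceType) (d : E -> E -> R)
    (X : set E) (f g : E -> E) (c : \bar R) : Prop :=
  lower_ac d X f g = c /\ upper_ac d X f g = c.

(* Main.v *)
Require Import Defs.
From HB Require Import structures.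
From mathcomp Require Import all_boot all_order all_algebra finmap.
From mathcomp Require Import all_classical all_reals all_analysis.
From mathcomp Require Import zify ring lra.

(* Call a pair of distinct letters forked when, for some [N], two positions [U < V]
   of the words [phi^N(c)], [c] in [A], carry the same idempotent self map of [A],
   fixing both letters; a pair is unforked when no forked pair descends from it.
   Being unforked is an equivalence relation compatible with [phi], and everything
   depends on whether [X] is periodic modulo this relation.

   If it is, the words [phi^n(c)] and [phi^n(d)] of an unforked pair differ in
   polynomially many positions, and two points with the same address (residue
   mod [k ^ n], class mod the period) differ with density polynomial in [n] times
   [k ^ -n]; this bounds the upper amorphic complexity by 1. Moreover a pair of
   sets of letters returns to itself under desubstitution along at most one
   residue, which bounds the sets shattered by it, so [X] is null.

   If it is not, then [X] modulo the relation is aperiodic, hence recognizable: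
   two shifts of a point by amounts that are distinct mod [k] differ, modulo the
   relation, with density bounded below. Along a forked pair differences grow
   exponentially, so that the lower amorphic complexity exceeds 1. Choosing
   between [U] and [V] independently at each scale produces an IT pair.

   Linear recurrence gives a lower amorphic complexity of at least 1 as soon as
   [X] is infinite. *)

Set Implicit Arguments.
Unset Strict Implicit.
Unset Printing Implicit Defensive.

Import Order.TTheory GRing.Theory Num.Theory.
Import numFieldNormedType.Exports.

Local Open Scope classical_set_scope.

(** * Densities and separation numbers *)

(** A fork lets one map [g] act at two places, so a pair fixed by [g] is copied to both, copied
    again inside each copy, and so on: the differences at scale [k ^ n] gain a factor exponential in
    [n]. This is what separates the exponent from 1. Conversely, two different positions along which
    a pair returns to itself always create a fork, because the words over these positions outnumber
    the self maps of [A]; an unforked pair therefore has a single way to return, and both upper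
    bounds rest on that.

    The obstacle is that unforked letters may still differ, at polynomially many places and at every
    level. Neither equality of letters nor a coincidence condition would do; the arguments run
    modulo [unforked], without forming the quotient alphabet. The polynomial factor is absorbed at
    the very end by a base slightly smaller than [k].

    Points are desubstituted on finite windows only. Where a choice has to hold for all windows at
    once, it is a choice from a finite set, and [uniform_colour] makes it uniform. *)

Definition hits (E : int -> bool) (a : int) n := \sum_(j < n) E (a + j%:Z)%R.

Lemma hitsD E (a : int) m n : hits E a (m + n) = hits E a m + hits E (a +
  m%:Z)%R n.
Proof.
rewrite /hits big_split_ord /=; congr (_ + _).
by apply: eq_bigr => j _; rewrite PoszD addrA.
Qed.

Lemma hits_sub E (a a' : int) n n' : (a' <= a)%R ->
  (a + n%:Z <= a' + n'%:Z)%R -> hits E a n <= hits E a' n'.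
Proof.
move=> h1 h2; pose u := `|(a - a')%R|%N.
have -> : n' = u + n + (n' - (u + n)) by rewrite /u; lia.
rewrite !hitsD; have -> : (a' + u%:Z = a)%R by rewrite /u; lia.
by rewrite -addnA addnCA leq_addr.
Qed.

Lemma leq_hits (E E' : int -> bool) (a : int) n :
  (forall i, E i -> E' i) -> hits E a n <= hits E' a n.
Proof.
by move=> h; apply: leq_sum => j _; move: (h (a + j%:Z)%R);
  case: (E _) => [->|].
Qed.

Lemma hits_ge E q L (a : int) n :
  (forall c, q <= hits E c L) -> q * n <= hits E a (L * n).
Proof.
move=> h; elim: n a => [|n IH] a; first by rewrite !muln0.
by rewrite !mulnS hitsD leq_add.
Qed.

Lemma hits_le E q L (a : int) n :
  (forall c, hits E c L <= q) -> hits E a (L * n) <= q * n.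
Proof.
move=> h; elim: n a => [|n IH] a; first by rewrite !muln0 /hits big_ord0.
by rewrite !mulnS hitsD leq_add.
Qed.


Section Counting.
Local Open Scope ring_scope.
Variable R : realType.

Lemma counting_ge (T : choiceType) (Z : set T) (s : seq T) : uniq s ->
  (forall x, x \in s -> Z x) -> ((size s)%:R%:E <= counting Z :> \bar R)%E.
Proof.
move=> us sZ; rewrite /counting; case: asboolP => [fZ|_]; last exact: leey.
rewrite lee_fin ler_nat.
by apply: uniq_leq_size => // x /sZ Zx; rewrite in_fset_set // inE.
Qed.

Lemma counting_le (T : choiceType) (C : finType) (Z : set T) (col : T -> C) :
  (forall x y, Z x -> Z y -> col x = col y -> x = y) ->
  (counting Z <= #|C|%:R%:E :> \bar R)%E.
Proof.
move=> inj; have le (B : {fset T}) : [set` B] `<=` Z -> (#|` B| <= #|C|)%N.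
  move=> BZ; rewrite cardE -(size_map col); apply: uniq_leq_size.
    rewrite map_inj_in_uniq ?fset_uniq // => x y xB yB; apply: inj; exact: BZ.
  by move=> c _; rewrite mem_enum.
rewrite /counting; case: asboolP => [fZ|nZ].
  by rewrite lee_fin ler_nat; apply: le; rewrite fset_setK.
have [B BZ] := infinite_set_fset #|C|.+1 nZ.
by rewrite ltnNge le.
Qed.

Lemma counting_window (D : set int) n :
  counting (D `&` [set l : int | `|l| <= n%:Z]) =
  (hits (fun l => `[< D l >]) (- n%:Z) (2 * n + 1))%:R%:E :> \bar R.
Proof.
pose s := [seq l <- [seq - n%:Z + j%:Z | j <- iota 0 (2 * n + 1)] | `[< D l >]].
have us : uniq s.
  by rewrite filter_uniq // map_inj_uniq ?iota_uniq // => i j; lia.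
have -> : D `&` [set l : int | `|l| <= n%:Z] = [set` [fset l in s]%fset].
  apply/seteqP; split => l /=; rewrite !inE /= mem_filter.
    move=> [Dl ln]; rewrite asboolT //=; apply/mapP.
    by exists `|(l + n%:Z)%R|%N; rewrite ?mem_iota; lia.
  move=> /andP[/asboolP + /mapP[j + lE]]; rewrite lE mem_iota => Dl jn.
  by split => //=; lia.
rewrite /counting asboolT // set_fsetK; congr (_%:R%:E).
have -> : #|` [fset l in s]%fset| = size s.
  by rewrite card_fseq undup_id.
rewrite size_filter count_map -sum1_count big_mkcond /= /hits.
rewrite -(big_mkord xpredT (fun j => nat_of_bool `[< D (- n%:Z + j%:Z) >])).
by rewrite /index_iota subn0; apply: eq_bigr => j _; case: asboolP.
Qed.

Lemma limn_esup_ge (u : nat -> \bar R) n0 c :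
  (forall n, (n0 <= n)%N -> (c <= u n)%E) -> (c <= limn_esup u)%E.
Proof.
move=> h; rewrite /limn_esup limf_esupE;
  apply: le_ereal_inf_tmp => _ [V [N _ NV] <-].
apply: le_ereal_sup_tmp; exists (u (maxn n0 N)); last exact/h/leq_maxl.
by exists (maxn n0 N) => //; apply: NV; exact: leq_maxr.
Qed.

Lemma limn_esup_le (u : nat -> \bar R) n0 c :
  (forall n, (n0 <= n)%N -> (u n <= c)%E) -> (limn_esup u <= c)%E.
Proof.
move=> h; rewrite /limn_esup limf_esupE; apply: ge_ereal_inf.
exists (ereal_sup (u @` [set n | (n0 <= n)%N])).
  by exists [set n | (n0 <= n)%N] => //; exists n0.
by apply: ge_ereal_sup => _ [n nn0 <-]; exact: h.
Qed.

(** The factor 2 pays for the incomplete last block: a window of length [2 n + 1 >= L] with [b >= 1]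
    complete blocks has length less than [(b + 1) L <= 2 b L]. *)
Lemma upper_density_ge (D : set int) q L : (0 < L)%N ->
  (forall a, (q <= hits (fun l => `[< D l >]) a L)%N) ->
  ((q%:R / (2 * L)%:R)%:E <= upper_density R D)%E.
Proof.
move=> L0 h; apply: (@limn_esup_ge _ L) => n Ln.
rewrite counting_window -EFinM lee_fin.
rewrite ler_pdivlMr ?ltr0n ?addn1 // mulrAC ler_pdivrMr ?ltr0n ?muln_gt0 //.
rewrite -!natrM ler_nat; set W := hits _ _ _.
pose b := ((2 * n).+1 %/ L)%N.
have b1 : (0 < b)%N by rewrite divn_gt0 //; lia.
have qb : (q * b <= W)%N.
  apply: leq_trans (hits_ge _ _ h) _; apply: hits_sub => //.
  by rewrite lerD2l lez_nat [leqLHS]mulnC leq_trunc_div.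
have : ((2 * n).+1 < b.+1 * L)%N by rewrite -ltn_divLR.
by move: qb b1; rewrite -/b; clearbody W b; clear; nia.
Qed.

Lemma upper_density_le (D : set int) q L : (0 < L)%N ->
  (forall a, (hits (fun l => `[< D l >]) a L <= q)%N) ->
  (upper_density R D <= ((2 * q)%:R / L%:R)%:E)%E.
Proof.
move=> L0 h; apply: (@limn_esup_le _ L) => n Ln.
rewrite counting_window -EFinM lee_fin.
rewrite ler_pdivrMr ?ltr0n ?addn1 // mulrAC ler_pdivlMr ?ltr0n //.
rewrite -!natrM ler_nat; set W := hits _ _ _.
pose b := ((2 * n).+1 %/ L)%N.
have b1 : (0 < b)%N by rewrite divn_gt0 //; lia.
have qb : (W <= q * b.+1)%N.
  apply: leq_trans (hits_le (- n%:Z) b.+1 h); apply: hits_sub => //.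
  by rewrite lerD2l lez_nat [leqRHS]mulnC ltnW // -ltn_divLR.
have : (b * L <= (2 * n).+1)%N by rewrite leq_trunc_div.
by move: qb b1; rewrite -/b; clearbody W b; clear; nia.
Qed.

End Counting.

Section Separation.
Local Open Scope ring_scope.
Variables (R : realType) (E : choiceType) (d : E -> E -> R) (X : set E).
Variables (f g : E -> E).

Lemma Sep_ge (z : nat -> E) delta nu M : (forall i, (i < M)%N -> X (z i)) ->
  (forall i j, (i < M)%N -> (j < M)%N -> i <> j ->
     z i <> z j /\ ac_separated d f g delta nu (z i) (z j)) ->
  (M%:R%:E <= Sep d X f g delta nu)%E.
Proof.
move=> zX zsep; apply: le_ereal_sup_tmp.
exists (counting [set z i | i in `I_M]).
  exists [set z i | i in `I_M] => //; split; first by move=> _ [i iM <-];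
    exact: zX.
  move=> _ _ [i iM <-] [j jM <-] ij; have ne : i <> j by move=> e;
    rewrite e in ij.
  by have [] := zsep i j iM jM ne.
rewrite -[M in (M%:R)%:E](size_iota 0) -(size_map z); apply: counting_ge.
  rewrite map_inj_in_uniq ?iota_uniq // => i j; rewrite !mem_iota => iM jM zij.
  by apply: contrapT => ne; have [] := zsep i j iM jM ne.
by move=> _ /mapP[i + ->]; rewrite mem_iota => iM; exists i.
Qed.

Lemma Sep_le (C : finType) (col : E -> C) delta nu :
  (forall x y, X x -> X y -> col x = col y ->
     ~ ac_separated d f g delta nu x y) ->
  (Sep d X f g delta nu <= #|C|%:R%:E)%E.
Proof.
move=> h; apply: ge_ereal_sup => _ [Z [ZX Zsep] <-].
apply: (@counting_le _ _ C Z col) => x y Zx Zy exy.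
by apply: contrapT => ne; apply: (h x y);
  [exact: ZX|exact: ZX|exact: exy|exact: Zsep].
Qed.

Lemma le_Sep delta nu nu' : nu <= nu' ->
  (Sep d X f g delta nu' <= Sep d X f g delta nu)%E.
Proof.
move=> le; apply: ereal_sup_le => _ [Z [ZX Zsep] <-]; exists Z => //;
  split => //.
move=> x y Zx Zy ne; apply: le_trans (Zsep x y Zx Zy ne).
by rewrite lee_fin.
Qed.

(** Comparing logarithms needs positive arguments; the value 0, for empty [X], is isolated here and
    handled by [ln 0 = 0]. *)
Lemma Sep_eq0_or_ge1 delta nu :
  (Sep d X f g delta nu = 0 \/ 1 <= Sep d X f g delta nu)%E.
Proof.
have [[x Xx]|X0] := pselect (exists x, X x).
  right; apply: (@Sep_ge (fun=> x) _ _ 1) => // i j.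
  by rewrite !ltnS !leqn0 => /eqP -> /eqP ->.
left; apply/eqP; rewrite eq_le; apply/andP; split.
  apply: ge_ereal_sup => _ [Z [ZX _] <-].
  have -> : Z = set0 by apply/seteqP; split => // x /ZX Xx; apply: X0; exists x.
  by rewrite /counting asboolT // fset_set0 cardfs0.
apply: le_ereal_sup_tmp; exists (counting (set0 : set E)).
  by exists set0 => //; split => // x y.
by rewrite /counting asboolT // fset_set0 cardfs0.
Qed.

Lemma ac_ratio_ge0 delta nu : 0 < nu < 1 -> (0 <= ac_ratio d X f g delta nu)%E.
Proof.
move=> nu01; apply: mule_ge0; last first.
  by rewrite lee_fin invr_ge0 oppr_ge0 ltW // ln_lt0.
case: (Sep_eq0_or_ge1 delta nu) => [->|]; first by rewrite /= ln0.
by case: (Sep _ _ _ _ _ _) => //= r; rewrite !lee_fin; exact: ln_ge0.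
Qed.

Lemma ac_ratio_ge delta nu (m : nat) : 0 < nu < 1 -> (0 < m)%N ->
  (m%:R%:E <= Sep d X f g delta nu)%E ->
  ((ln m%:R / - ln nu)%:E <= ac_ratio d X f g delta nu)%E.
Proof.
move=> nu01 m0 h; have t0 : 0 < - ln nu by rewrite oppr_gt0 ln_lt0.
rewrite EFinM /ac_ratio; apply: lee_wpmul2r;
  first by rewrite lee_fin invr_ge0; exact: ltW.
move: h; case: (Sep _ _ _ _ _ _) => //= [r|_]; last exact: leey.
rewrite !lee_fin => mr; rewrite ler_ln ?posrE ?ltr0n //.
by apply: lt_le_trans mr; rewrite ltr0n.
Qed.

Lemma ac_ratio_le delta nu (m : nat) : 0 < nu < 1 -> (0 < m)%N ->
  (Sep d X f g delta nu <= m%:R%:E)%E ->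
  (ac_ratio d X f g delta nu <= (ln m%:R / - ln nu)%:E)%E.
Proof.
move=> nu01 m0 h; have t0 : 0 < - ln nu by rewrite oppr_gt0 ln_lt0.
rewrite EFinM /ac_ratio; apply: lee_wpmul2r;
  first by rewrite lee_fin invr_ge0; exact: ltW.
case: (Sep_eq0_or_ge1 delta nu) => [->|].
  by rewrite /= ln0 // lee_fin ln_ge0 // ler1n.
move: h; case: (Sep _ _ _ _ _ _) => //= r; rewrite !lee_fin => rm r1.
by rewrite ler_ln ?posrE ?ltr0n // (lt_le_trans _ r1).
Qed.

End Separation.

Section SmallParameter.
Local Open Scope ring_scope.
Variable R : realType.
Implicit Types (u : R -> \bar R) (c : R).

Lemma near0_right (nu0 : R) : 0 < nu0 ->
  (0 : R)^'+ [set nu | 0 < nu < nu0].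
Proof.
move=> h; apply: filterS2 (nbhs_right_gt (0 : R)) (nbhs_right_lt h).
by move=> x /= -> ->.
Qed.

Lemma esup_right_le u c : (forall e, 0 < e -> exists2 nu0, 0 < nu0 &
    forall nu, 0 < nu < nu0 -> (u nu <= (c + e)%:E)%E) ->
  (limf_esup u (0 : R)^'+ <= c%:E)%E.
Proof.
move=> h; apply/lee_addgt0Pr => e e0; rewrite limf_esupE; apply: ge_ereal_inf.
have [nu0 nu00 H] := h e e0; exists (ereal_sup (u @` [set nu | 0 < nu < nu0])).
  by exists [set nu | 0 < nu < nu0] => //; exact: near0_right.
by apply: ge_ereal_sup => _ [nu nuI <-]; rewrite -EFinD; exact: H.
Qed.

Lemma einf_right_ge u c : (forall e, 0 < e -> exists2 nu0, 0 < nu0 &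
    forall nu, 0 < nu < nu0 -> ((c - e)%:E <= u nu)%E) ->
  (c%:E <= limf_einf u (0 : R)^'+)%E.
Proof.
move=> h; apply/lee_subgt0Pr => e e0; rewrite limf_einfE;
  apply: le_ereal_sup_tmp.
have [nu0 nu00 H] := h e e0; exists (ereal_inf (u @` [set nu | 0 < nu < nu0])).
  by exists [set nu | 0 < nu < nu0] => //; exact: near0_right.
by apply: le_ereal_inf_tmp => _ [nu nuI <-]; rewrite -EFinB; exact: H.
Qed.

Lemma einf_le_esup u : (limf_einf u (0 : R)^'+ <= limf_esup u (0 : R)^'+)%E.
Proof.
rewrite limf_einfE limf_esupE; apply: ge_ereal_sup => _ [V FV <-].
apply: le_ereal_inf_tmp => _ [W FW <-].
have /filter_ex[nu [Vnu Wnu]] : (0 : R)^'+ (V `&` W) by exact: filterI.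
apply: (@le_trans _ _ (u nu)).
  by apply: ereal_inf_lbound; exists nu.
by apply: ereal_sup_ubound; exists nu.
Qed.

Lemma ln_small (T nu : R) : 0 < nu < expR (- T) -> T < - ln nu.
Proof.
move=> /andP[nu0 nuT]; rewrite ltrNr -[ltRHS]expRK ltr_ln ?posrE ?expR_gt0 //.
Qed.

End SmallParameter.

Section AmorphicBounds.
Local Open Scope ring_scope.
Variables (R : realType) (E : choiceType) (d : E -> E -> R) (X : set E).
Variables (f g : E -> E).

(** Separation numbers decrease in [nu], so a geometric sequence of parameters suffices: rounding
    costs a bounded amount in [- ln nu], less than the margin [e * t] once [t = - ln nu] exceeds
    [T]. *)
Lemma einf_ac_ratio_ge delta (K : nat) (B C : R) : (0 < K)%N -> 1 < B ->
  0 < C ->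
  (forall N, ((K ^ N)%:R%:E <= Sep d X f g delta ((C * B ^+ N)^-1))%E) ->
  ((ln K%:R / ln B)%:E <=
   limf_einf (ac_ratio d X f g delta) (0 : R)^'+)%E.
Proof.
move=> K0 B1 C0 H; apply: einf_right_ge => e e0.
set k := ln K%:R; set b := ln B; set a := ln C.
have b0 : 0 < b by exact: ln_gt0.
have k0 : 0 <= k by rewrite ln_ge0 // ler1n.
pose D := (`|a| + b) * k.
pose T := Num.max (`|a| + 1) (D / (e * b)).
exists (expR (- T)) => [|nu nuT]; first exact: expR_gt0.
have nu0 : 0 < nu by case/andP: nuT.
have := ln_small nuT; set t := - ln nu; rewrite gt_max => /andP[ta tD].
have aa := ler_norm a.
have t0 : 0 < t by apply: lt_trans ta; rewrite ltr_wpDl.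
have nu01 : 0 < nu < 1 by rewrite nu0 /= -ltr_ln ?posrE // ln1 -oppr_gt0.
have ta0 : 0 <= (t - a) / b by rewrite divr_ge0 ?ltW // subr_gt0; lra.
(* [N] is the largest index with [nu <= (C * B ^+ N)^-1]. *)
have /andP[Nle Ngt] := truncn_itv ta0; set N := Num.truncn _ in Nle Ngt.
rewrite ler_pdivlMr // in Nle; rewrite ltr_pdivrMr // in Ngt.
have SepN : ((K ^ N)%:R%:E <= Sep d X f g delta nu)%E.
  apply: le_trans (H N) _; apply: le_Sep.
  have CB0 : 0 < C * B ^+ N by rewrite mulr_gt0 // exprn_gt0 // (lt_trans
    ltr01).
  rewrite -[leLHS]invrK lef_pV2 ?posrE ?invr_gt0 //.
  rewrite -ler_ln ?posrE ?invr_gt0 // lnV ?posrE // lnM ?posrE //; last first.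
    by rewrite exprn_gt0 // (lt_trans ltr01).
  by rewrite lnXn ?(lt_trans ltr01) // -/a -/b -/t -mulr_natl -lerBrDl.
apply: le_trans (ac_ratio_ge nu01 _ SepN); last by rewrite expn_gt0 K0.
rewrite lee_fin -/t natrX lnXn ?ltr0n // -/k -mulr_natl ler_pdivlMr //.
rewrite ltr_pdivrMr ?mulr_gt0 // in tD.
rewrite -(ler_pM2r b0); have qb : k / b * b = k by rewrite divfK ?gt_eqF.
have -> : (k / b - e) * t * b = (k / b * b) * t - t * (e * b) by ring.
rewrite qb.
have h1 : k * (t - a - b) <= k * (N%:R * b) by rewrite ler_wpM2l //;
  rewrite -natr1 in Ngt; lra.
have h2 : (a + b) * k <= D by rewrite /D ler_wpM2r // lerD2r.
by lra.
Qed.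

Lemma esup_ac_ratio_le delta (K h : nat) (B C : R) : (0 < K)%N -> (0 < h)%N ->
  1 < B -> 0 < C ->
  (forall N, (Sep d X f g delta (C / B ^+ N) <= (h * K ^ N)%:R%:E)%E) ->
  (limf_esup (ac_ratio d X f g delta) (0 : R)^'+ <= (ln K%:R / ln B)%:E)%E.
Proof.
move=> K0 h0 B1 C0 H; apply: esup_right_le => e e0.
set k := ln K%:R; set b := ln B; set a := ln C.
have b0 : 0 < b by exact: ln_gt0.
have k0 : 0 <= k by rewrite ln_ge0 // ler1n.
pose D := (`|a| + b) * k + b * ln h%:R.
pose T := Num.max (`|a| + 1) (D / (e * b)).
exists (expR (- T)) => [|nu nuT]; first exact: expR_gt0.
have nu0 : 0 < nu by case/andP: nuT.
have := ln_small nuT; set t := - ln nu; rewrite gt_max => /andP[ta tD].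
have aa := ler_norm a; have aN := ler_norm (- a); rewrite normrN in aN.
have t0 : 0 < t by apply: lt_trans ta; rewrite ltr_wpDl.
have nu01 : 0 < nu < 1 by rewrite nu0 /= -ltr_ln ?posrE // ln1 -oppr_gt0.
have ta0 : 0 <= (t + a) / b by rewrite divr_ge0 ?ltW //; lra.
(* [N.+1] is the first index with [C / B ^+ N.+1 < nu]. *)
have /andP[Nle Ngt] := truncn_itv ta0; set N := Num.truncn _ in Nle Ngt.
rewrite ler_pdivlMr // in Nle; rewrite ltr_pdivrMr // in Ngt.
have SepN : (Sep d X f g delta nu <= (h * K ^ N.+1)%:R%:E)%E.
  apply: le_trans (H N.+1); apply: le_Sep.
  have BN0 : 0 < B ^+ N.+1 by rewrite exprn_gt0 // (lt_trans ltr01).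
  rewrite -ler_ln ?posrE ?divr_gt0 // ln_div ?posrE // lnXn ?(lt_trans ltr01)
    //.
  by rewrite -/a -/b -mulr_natl lerBlDr -lerBlDl ltW // addrC.
apply: le_trans (ac_ratio_le nu01 _ SepN) _;
  first by rewrite muln_gt0 h0 expn_gt0 K0.
rewrite lee_fin -/t natrM natrX lnM ?posrE ?exprn_gt0 ?ltr0n // lnXn ?ltr0n //.
rewrite -/k -[k *+ _]mulr_natl ler_pdivrMr // -natr1.
rewrite ltr_pdivrMr ?mulr_gt0 // in tD.
rewrite -(ler_pM2r b0); have qb : k / b * b = k by rewrite divfK ?gt_eqF.
have -> : (k / b + e) * t * b = (k / b * b) * t + t * (e * b) by ring.
rewrite qb.
have h1 : k * (N%:R * b) <= k * (t + a) by rewrite ler_wpM2l.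
have h2 : (a + b) * k <= (`|a| + b) * k by rewrite ler_wpM2r // lerD2r.
by rewrite /D in tD; lra.
Qed.

End AmorphicBounds.

(** * Letters, positions and inflation *)

Section ConstantLength.
Variables (A : finType) (phi : A -> seq A) (k : nat).
Hypotheses (hk : 1 < k) (hlen : constant_length phi k) (hprim : primitive phi).

Implicit Types (a b : A) (x y : int -> A).

(* [letter n i a] is the letter at position [i] of [phi^n(a)]; a position
   [i >= k ^ n] is read modulo [k ^ n]. *)
Fixpoint letter (n i : nat) a : A :=
  if n is m.+1 then
    let b := letter m (i %/ k) a in nth b (phi b) (i %% k)
  else a.

Let k_gt0 : 0 < k. Proof. exact: ltnW. Qed.

Let expk_gt0 n : 0 < k ^ n. Proof. by rewrite expn_gt0 k_gt0. Qed.

#[local] Hint Resolve expk_gt0 : core.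

Lemma letterD m n i j a : j < k ^ n ->
  letter (m + n) (i * k ^ n + j) a = letter n j (letter m i a).
Proof.
elim: n j => [|n IHn] j jk.
  by move: jk; rewrite expn0 ltnS leqn0 => /eqP ->; rewrite muln1 !addn0.
rewrite addnS /= expnSr mulnA divnMDl // modnMDl.
by rewrite IHn // ltn_divLR // -expnSr.
Qed.

Lemma letter_mod n i a : letter n (i %% k ^ n) a = letter n i a.
Proof.
rewrite [in RHS](divn_eq i (k ^ n)) -[n in RHS]add0n letterD ?ltn_mod //.
Qed.

Lemma nth_subst_ext s (e : A) i : i < size s * k ->
  nth e (subst_ext phi s) i = nth e (phi (nth e s (i %/ k))) (i %% k).
Proof.
rewrite /subst_ext; elim: s i => [|a s IHs] i //= ilt.
rewrite nth_cat hlen; case: ltnP => ik;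
  first by rewrite divn_small // modn_small.
have -> : i %/ k = ((i - k) %/ k).+1.
  by rewrite -{1}(subnK ik) divnDr // divnn k_gt0 addn1.
have -> : i %% k = (i - k) %% k by rewrite -{1}(subnK ik) modnDr.
by rewrite IHs //= ltn_subLR.
Qed.

Lemma size_subst_ext s : size (subst_ext phi s) = size s * k.
Proof. by elim: s => //= a s; rewrite /subst_ext /= size_cat hlen => ->. Qed.

Lemma subst_iterE n a :
  subst_iter phi n a = mkseq (fun i => letter n i a) (k ^ n).
Proof.
elim: n => [|n IHn] //; rewrite /subst_iter iterS -/(subst_iter phi n a) IHn.
have szE : size (subst_ext phi (mkseq (fun i =>
  letter n i a) (k ^ n))) = k ^ n.+1.
  by rewrite size_subst_ext size_mkseq -expnSr.
apply: (@eq_from_nth _ a); first by rewrite szE size_mkseq.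
move=> i; rewrite szE => ilt.
rewrite nth_subst_ext ?size_mkseq -?expnSr //.
rewrite [in RHS]nth_mkseq //= nth_mkseq ?ltn_divLR -?expnSr //.
by apply: set_nth_default; rewrite hlen ltn_mod.
Qed.

Lemma infix_subst_iterP (w : seq A) n a : infix w (subst_iter phi n a) <->
  exists2 p, p + size w <= k ^ n &
    w = mkseq (fun j => letter n (p + j) a) (size w).
Proof.
rewrite subst_iterE; split.
  move=> /infixP[s1 [s2 E]]; have := congr1 size E.
  rewrite size_mkseq !size_cat => sz.
  have wk : size s1 + size w <= k ^ n by rewrite sz addnA leq_addr.
  exists (size s1) => //.
  apply: (@eq_from_nth _ a); rewrite ?size_mkseq // => j jw.
  rewrite nth_mkseq //; have := congr1 (nth a ^~ (size s1 + j)) E.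
  rewrite nth_mkseq; last by rewrite (leq_trans _ wk) // ltn_add2l.
  move=> ->; rewrite nth_cat ltnNge leq_addr /=.
  by rewrite addKn nth_cat jw.
move=> [p]; move szw: (size w) => l plt wE; apply/infixP.
set u := mkseq _ (k ^ n); have szu : size u = k ^ n by rewrite size_mkseq.
exists (take p u), (drop (p + l) u).
rewrite -[LHS](cat_take_drop (p + l)) catA; congr (_ ++ _).
have szt : size (take (p + l) u) = p + l by rewrite size_takel ?szu.
have szp : size (take p u) = p.
  by rewrite size_takel // szu (leq_trans _ plt) ?leq_addr.
apply: (@eq_from_nth _ a); first by rewrite szt size_cat szp szw.
move=> j; rewrite szt => jlt.
rewrite nth_take // nth_mkseq ?(leq_trans jlt) // nth_cat szp.
case: ltnP => jp.
  by rewrite nth_take // nth_mkseq // (leq_trans jlt).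
rewrite wE nth_mkseq; last by rewrite ltn_subLR.
by rewrite subnKC.
Qed.

Lemma subshiftP x : subshift phi x <-> forall (i : int) (l : nat),
  exists a n p, p + l <= k ^ n /\
    forall j, j < l -> x (i + j%:Z)%R = letter n (p + j) a.
Proof.
split=> [Xx i l|H w [i wE]].
  have [|a [n]] := Xx (mkseq (fun j => x (i + j%:Z)%R) l).
    by exists i; rewrite size_mkseq.
  move=> /infix_subst_iterP[p]; rewrite size_mkseq => pl E.
  exists a, n, p; split => // j jl; have := congr1 (nth a ^~ j) E.
  by rewrite !nth_mkseq.
have [a [n [p [pl E]]]] := H i (size w).
exists a, n; apply/infix_subst_iterP; exists p => //.
rewrite [LHS]wE; apply/eq_in_map => j; rewrite mem_iota add0n => /andP[_ jw].
exact: E.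
Qed.

(** Primitivity passes to larger exponents: the descendants in [phi^n(b)] of the first letter of
    [phi^(n - n0)(b)] already show every letter. *)
Lemma all_letters_occur : exists n0, forall n, n0 <= n -> forall a b,
  exists2 q, q < k ^ n & letter n q b = a.
Proof.
have [n0 _ H] := hprim; exists n0 => n n0n a b.
have [c cE] : exists c, letter (n - n0) 0 b = c by eexists.
have := H c a; rewrite subst_iterE => /mapP[q].
rewrite mem_iota add0n => /andP[_ qk] ->.
exists q; first by rewrite (leq_trans qk) // leq_pexp2l.
rewrite -[q]add0n -(mul0n (k ^ n0)) -(subnK n0n) letterD //.
by rewrite cE mul0n.
Qed.

Lemma window_in_power x b (i : int) l : subshift phi x ->
  exists n0, forall n, n0 <= n -> exists2 p, p + l <= k ^ n &
    forall j, j < l -> x (i + j%:Z)%R = letter n (p + j) b.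
Proof.
move=> /subshiftP /(_ i l)[a [m [p [pl E]]]].
have [n1 H] := all_letters_occur.
exists (n1 + m) => n nlt.
have [|q qk qE] := H (n - m) _ a b; first by lia.
have mn : m <= n by lia.
exists (q * k ^ m + p).
  rewrite -addnA (leq_trans (leq_add (leqnn _) pl)) // -mulSnr.
  by rewrite -[in k ^ n](subnK mn) expnD leq_mul2r qk orbT.
move=> j jl; rewrite E // -[in RHS](subnK mn) -addnA letterD ?qE //.
by rewrite (leq_trans _ pl) // ltn_add2l.
Qed.

Definition shift_by (t : int) x : int -> A := fun i => x (i + t)%R.

Lemma subshift_shift_by t x : subshift phi (shift_by t x) <-> subshift phi x.
Proof.
split=> /subshiftP Xx; apply/subshiftP => i l.
  have [a [n [p [pl E]]]] := Xx (i - t)%R l; exists a, n, p; split => // j jl.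
  by rewrite -E // /shift_by; congr x; lia.
have [a [n [p [pl E]]]] := Xx (i + t)%R l; exists a, n, p; split => // j jl.
by rewrite -E // /shift_by; congr x; lia.
Qed.

(** This is [T^r(phi^n(x))]. *)
Definition inflate n (r : int) x : int -> A := fun i =>
  letter n `|((i + r) %% (k ^ n)%:Z)%Z|%N (x ((i + r) %/ (k ^ n)%:Z)%Z).

Lemma inflateE n r x (q i : int) j : j < k ^ n ->
  (i + r = q * (k ^ n)%:Z + j%:Z)%R -> inflate n r x i = letter n j (x q).
Proof.
move=> jk E; rewrite /inflate E.
have k0 : ((k ^ n)%:Z != 0)%R by have := expk_gt0 n; lia.
rewrite divzMDl // modzMDl divz_small ?addr0; last by lia.
by rewrite modz_small //; lia.
Qed.

Lemma pos_decomp n (i : int) : exists (q : int) (j : nat), j < k ^ n /\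
  i = (q * (k ^ n)%:Z + j%:Z)%R.
Proof.
exists (i %/ (k ^ n)%:Z)%Z, `|(i %% (k ^ n)%:Z)%Z|%N.
have k0 : ((k ^ n)%:Z != 0)%R by have := expk_gt0 n; lia.
have := modz_ge0 i k0; have := ltz_mod i k0; have := divz_eq i (k ^ n)%:Z.
lia.
Qed.

Lemma inflate_shift_by n r q x i :
  inflate n r (shift_by q x) i = inflate n (r + q * (k ^ n)%:Z)%R x i.
Proof.
have [p [j [jk E]]] := pos_decomp n (i + r)%R.
rewrite (@inflateE _ _ _ p _ j) // (@inflateE _ _ _ (p + q)%R _ j) //.
by rewrite addrA E mulrDl addrAC.
Qed.

Lemma inflate_inflate m n r x i :
  inflate n r (inflate m 0 x) i = inflate (m + n) r x i.
Proof.
have [p [j [jk E]]] := pos_decomp n (i + r)%R.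
have [q [l [lk E']]] := pos_decomp m p.
rewrite (inflateE _ jk E) (@inflateE m 0 x q p l) ?addr0 //.
rewrite (@inflateE _ _ _ q _ (l * k ^ n + j)) ?letterD //.
  rewrite expnD; apply: (@leq_trans (l.+1 * k ^ n)).
    by rewrite mulSnr ltn_add2l.
  by rewrite leq_mul2r lk orbT.
by rewrite E E' expnD; lia.
Qed.

Lemma subshift_inflate n r x : subshift phi x -> subshift phi (inflate n r x).
Proof.
move=> /subshiftP Xx; apply/subshiftP => i l.
have [q [j0 [j0k E]]] := pos_decomp n (i + r)%R.
have [a [m [p [pl Em]]]] := Xx q (j0 + l).
exists a, (m + n), (p * k ^ n + j0); split.
  have := expk_gt0 n; move: pl j0k; rewrite expnD.
  move: (k ^ m) (k ^ n) => M K; nia.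
move=> j jl; have Kgt0 := expk_gt0 n.
have sE := divn_eq (j0 + j) (k ^ n).
have slt : (j0 + j) %% k ^ n < k ^ n by rewrite ltn_mod.
have dle : (j0 + j) %/ k ^ n <= j0 + j by exact: leq_div.
rewrite (@inflateE _ _ _ (q + ((j0 + j) %/ k ^ n)%:Z)%R _
  ((j0 + j) %% k ^ n)) //; last first.
  by move: E sE; move: (_ %/ _) (_ %% _) => u v; lia.
rewrite Em; last by lia.
by rewrite -letterD //; congr letter; lia.
Qed.

(** * Points of the subshift and recurrence *)

(* [p, ..., p] in base [k ^ N]: the position around which the words
   [phi^(N m)(a)] stabilise when [p] is a position of [a] in [phi^N(a)]. *)
Fixpoint centre (N p m : nat) : nat :=
  if m is m'.+1 then p * k ^ (N * m') + centre N p m' else 0.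

(** [p] is neither the first nor the last position of the block, so each level adds room on both
    sides. *)
Lemma centre_bounds N p m : 0 < p -> p.+1 < k ^ N ->
  m <= centre N p m /\ centre N p m + m < k ^ (N * m).
Proof.
move=> p0 pk; elim: m => [|m [IH1 IH2]]; first by rewrite muln0.
rewrite /= mulnS expnD; move: IH2 pk; have := expk_gt0 (N * m).
move: (k ^ (N * m)) (k ^ N) (centre N p m) IH1 => K L e; nia.
Qed.

Definition in_centre N p m (i : int) :=
  ((0 <= (centre N p m)%:Z + i) /\
   ((centre N p m)%:Z + i < (k ^ (N * m))%:Z))%R.

Lemma in_centreW N p m m' i : p < k ^ N -> m <= m' ->
  in_centre N p m i -> in_centre N p m' i.
Proof.
move=> pk /subnK <- h; elim: (m' - m) => // e; rewrite /in_centre.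
rewrite addSn /= mulnS expnD; have := expk_gt0 (N * (e + m)).
by move: (k ^ _) (k ^ N) (centre N p _) pk => K L c; nia.
Qed.

Lemma letter_centre N p a m m' (i : int) : p < k ^ N -> letter N p a = a ->
  m <= m' -> in_centre N p m i ->
  letter (N * m') `|((centre N p m')%:Z + i)%R|%N a =
  letter (N * m) `|((centre N p m)%:Z + i)%R|%N a.
Proof.
move=> pk pa /subnK <-; elim: (m' - m) => // e IH im; rewrite -IH //.
have [c0 c1] := in_centreW pk (leq_addl e m) im.
rewrite addSn /= mulnS -[in RHS]pa -letterD; last by lia.
by congr letter; lia.
Qed.

Lemma limit_point N p a : 0 < p -> p.+1 < k ^ N -> letter N p a = a ->
  exists2 x, subshift phi x & forall m i, in_centre N p m i ->
    x i = letter (N * m) `|((centre N p m)%:Z + i)%R|%N a.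
Proof.
move=> p0 pk pa; pose M (i : int) := `|i|%N.+1.
have inM m i : `|i|%N < m -> in_centre N p m i.
  by move=> im; have := centre_bounds m p0 pk; rewrite /in_centre; lia.
have pk' : p < k ^ N by exact: ltnW.
pose x (i : int) := letter (N * M i) `|((centre N p (M i))%:Z + i)%R|%N a.
have xE m i : in_centre N p m i ->
    x i = letter (N * m) `|((centre N p m)%:Z + i)%R|%N a.
  move=> im; rewrite /x; have iM := inM (M i) i (leqnn _).
  case: (leqP (M i) m) => [|/ltnW] h; last exact: letter_centre.
  by apply/esym/letter_centre.
exists x => //; apply/subshiftP => i l.
pose m := (`|i|%N + `|(i + l%:Z)%R|%N).+1.
have [c1 c2] := centre_bounds m p0 pk.
exists a, (N * m), `|((centre N p m)%:Z + i)%R|%N; split; first by lia.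
move=> j jl; rewrite (xE m); last by apply: inM; lia.
by congr letter; lia.
Qed.

Lemma point_at a : exists2 x, subshift phi x & x 0%R = a.
Proof.
have [n0 H] := all_letters_occur.
(* Position 1 of [phi^2(a)] is interior since [k ^ 2 >= 4]; an occurrence of [a] among its
   descendants is then interior too, as [limit_point] requires. *)
have [q qk qE] := H n0 (leqnn _) a (letter 2 1 a).
have aE : letter (2 + n0) (1 * k ^ n0 + q) a = a by rewrite letterD.
have [||x Xx xE] := limit_point _ _ aE.
- by rewrite mul1n addn_gt0 expk_gt0.
- rewrite expnD; have : 4 <= k ^ 2 by rewrite -[4]/(2 ^ 2) leq_exp2r.
  move: (k ^ 2) qk => K; have := expk_gt0 n0; nia.
by exists x => //; rewrite (xE 0) // /in_centre muln0.
Qed.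

Lemma word_in_point n p a : exists2 x, subshift phi x & forall i : int,
  (0 <= p%:Z + i)%R -> (p%:Z + i < (k ^ n)%:Z)%R ->
  x i = letter n `|(p%:Z + i)%R|%N a.
Proof.
have [x Xx x0] := point_at a; exists (inflate n p%:Z x).
  exact: subshift_inflate.
by move=> i i0 ik; rewrite (@inflateE _ _ _ 0%R _ `|(p%:Z + i)%R|%N) ?x0 //;
  lia.
Qed.

(** The window is a word of [phi^N(phi^n0(a))] for a letter [a], and [phi^n0(a)] sits in a point of
    the subshift. Both [r] and [y] may depend on the window. *)
Lemma desubstitute x N (n : nat) : subshift phi x ->
  exists r y, [/\ r < k ^ N, subshift phi y &
    forall i : int, `|i|%N <= n -> x i = inflate N r%:Z y i].
Proof.
move=> Xx; have [n0 H] := window_in_power (x 0%R) (- n%:Z)%R n.*2.+1 Xx.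
have [p pl E] := H (n0 + N) (leq_addr _ _).
have [y Xy yE] := word_in_point n0 0 (x 0%R).
have [q [r [rk rE]]] := pos_decomp N (p + n)%:Z.
exists r, (shift_by q y); split => //; first exact/subshift_shift_by.
move=> i ni; rewrite inflate_shift_by.
have -> : x i = x (- n%:Z + `|(n%:Z + i)%R|%N%:Z)%R by congr x; lia.
rewrite E; last by lia.
set s := p + _.
have sE := divn_eq s (k ^ N).
have sN : s %% k ^ N < k ^ N by rewrite ltn_mod expk_gt0.
have sD : s %/ k ^ N < k ^ n0 by rewrite ltn_divLR ?expk_gt0 // -expnD
  (leq_trans _ pl) // ltn_add2l; lia.
rewrite (@inflateE _ _ _ (s %/ k ^ N)%:Z _ (s %% k ^ N)) //; last first.
  have : s = p + `|(n%:Z + i)%R|%N by [].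
  by move: rE; move: (s %/ _) (s %% _) sE => u v ->; lia.
by rewrite yE // [in LHS]sE letterD.
Qed.

Lemma legal_pairs_occur : exists n, forall y (q : int) b, subshift phi y ->
  exists p, [/\ p + 2 <= k ^ n, letter n p b = y q &
    letter n p.+1 b = y (q + 1)%R].
Proof.
have /choice[f fP] (t : A * A * A) : exists n0, forall n, n0 <= n ->
    forall y q, subshift phi y -> y q = t.1.1 -> y (q + 1)%R = t.1.2 ->
    exists p, [/\ p + 2 <= k ^ n, letter n p t.2 = t.1.1 &
      letter n p.+1 t.2 = t.1.2].
  case: t => [[u v] b] /=.
  have [[y [q [Xy yu yv]]]|no] := pselect (exists y q,
      [/\ subshift phi y, y q = u & y (q + 1)%R = v]); last first.
    by exists 0 => n _ y q Xy yu yv; case: no; exists y, q.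
  have [n0 H] := window_in_power b q 2 Xy; exists n0 => n /H[p pk E] _ _ _ _ _.
  exists p; split => //; first by have := E 0 isT; rewrite addn0 addr0 yu.
  by have := E 1 isT; rewrite addn1 yv.
exists (\max_t f t) => y q b Xy.
by apply: (fP (y q, y (q + 1)%R, b) _ _ y q) => //; exact: leq_bigmax.
Qed.

(** A word of length [k ^ N] is covered by two adjacent blocks of level [N]. That pair of blocks
    occurs in every block of level [n2 + N], and a window of twice the length of such a block
    contains a complete one. *)
Lemma linear_recurrence : exists n2, forall N x y (i i' : int),
  subshift phi x -> subshift phi y ->
  exists o, o + k ^ N <= 2 * k ^ (n2 + N) /\
    forall j, j < k ^ N -> x (i' + o%:Z + j%:Z)%R = y (i + j%:Z)%R.
Proof.
have [n2 H] := legal_pairs_occur; exists n2 => N x y i i' Xx Xy.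
have [r [z [rk Xz yE]]] := desubstitute N (`|i|%N + k ^ N) Xy.
have [r' [w [rk' Xw xE]]] :=
  desubstitute (n2 + N) (`|i'|%N + (2 * k ^ (n2 + N))) Xx.
have [q [j0 [j0k iE]]] := pos_decomp N (i + r%:Z)%R.
have [q' [j' [jk' iE']]] := pos_decomp (n2 + N) (i' + r'%:Z)%R.
have [p [pk pE1 pE2]] := H z q (w (q' + 1)%R) Xz.
have pK : p * k ^ N + 2 * k ^ N <= k ^ (n2 + N).
  by rewrite expnD -mulnDl leq_mul2r pk orbT.
exists (k ^ (n2 + N) - j' + p * k ^ N + j0); split; first by lia.
move=> j jk; rewrite xE; last by lia.
rewrite yE; last by lia.
rewrite (@inflateE _ _ _ (q' + 1)%R _ (p * k ^ N + (j0 + j))); first last.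
- by move: iE' jk'; move: (k ^ (n2 + N)) (p * k ^ N) => K u; lia.
- by lia.
have [jj|jj] := ltnP (j0 + j) (k ^ N).
  rewrite letterD // pE1 (@inflateE _ _ _ q _ (j0 + j)) //.
  by move: iE; move: (k ^ N) => K; lia.
have -> : p * k ^ N + (j0 + j) = p.+1 * k ^ N + (j0 + j - k ^ N) by lia.
rewrite letterD ?pE2; last by lia.
rewrite (@inflateE _ _ _ (q + 1)%R _ (j0 + j - k ^ N)) //; first by lia.
by move: iE jj; move: (k ^ N) => K; lia.
Qed.

(* Linear recurrence makes a single failure of [p]-periodicity reappear in every
   window whose length is a fixed multiple of [p]. *)
Lemma recurrent_mismatch (e : A -> A -> Prop) :
  (forall p, 0 < p -> exists x (i : int),
     subshift phi x /\ ~ e (x i) (x (i + p%:Z)%R)) ->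
  exists2 C, 0 < C & forall p x (i : int), 0 < p -> subshift phi x ->
    exists2 j, j < C * p & ~ e (x (i + j%:Z)%R) (x (i + j%:Z + p%:Z)%R).
Proof.
move=> H; have [n2 R] := linear_recurrence.
exists (2 * k ^ n2 * (2 * k)); first by rewrite !muln_gt0 expk_gt0 k_gt0.
move=> p x i p0 Xx; have [y [i0 [Xy yi]]] := H p p0.
(* The least [N] with [p < k ^ N]: a word of this length holds both positions of the mismatch, and
   [k ^ N <= k * p] keeps the bound linear in [p]. *)
pose N := (trunc_log k p).+1.
have pN : p < k ^ N by rewrite trunc_log_ltn.
have Np : k ^ N <= k * p by rewrite expnS leq_mul2l trunc_logP ?orbT.
have [s [ok E]] := R N x y i0 i Xx Xy.
exists s.
  rewrite (@leq_trans (2 * k ^ (n2 + N))) //.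
    by rewrite (leq_trans _ ok) // -addn1 leq_add2l.
  by rewrite expnD; move: (k ^ N) (k ^ n2) Np => K L; nia.
have := E 0 (expk_gt0 N); have := E p pN.
by rewrite !addr0 => -> ->.
Qed.

(** * Forked pairs *)

Lemma letter_comp n m i j a :
  letter m j (letter n i a) = letter (n + m) (i * k ^ m + j %% k ^ m) a.
Proof. by rewrite letterD ?ltn_mod // letter_mod. Qed.

Lemma centre_lt N p m : p < k ^ N -> centre N p m < k ^ (N * m).
Proof.
move=> pk; have := @in_centreW N p 0 m 0 pk (leq0n _).
by rewrite /in_centre muln0 !addr0 /= => h; have := (h (conj isT isT)).2; lia.
Qed.

Lemma letter_centreE N p m a : p < k ^ N ->
  letter (N * m) (centre N p m) a = iter m (letter N p) a.
Proof.
move=> pk; elim: m a => [|m IH] a; first by rewrite muln0.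
by rewrite mulnS [centre _ _ _]/= letterD ?centre_lt // IH -iterSr.
Qed.

Lemma centre_mono N p q m : p < q -> 0 < m -> centre N p m < centre N q m.
Proof.
move=> pq; case: m => // m _ /=; rewrite -addSn leq_add //.
  by rewrite -addn1 (leq_trans (leq_add (leqnn _) (expk_gt0 (N * m)))) // addnC
    -mulSn leq_mul2r pq orbT.
elim: m => //= m IH; rewrite leq_add // leq_mul2r (ltnW pq) orbT //.
Qed.

(** The number with base [k ^ N] digits [s], most significant first. As a position it composes the
    maps [letter N v], the first digit acting first. *)
Fixpoint code (N : nat) (s : seq nat) : nat :=
  if s is d :: s' then d * k ^ (N * size s') + code N s' else 0.

Lemma code_lt N s : all (fun v => v < k ^ N) s -> code N s < k ^ (N * size s).
Proof.
elim: s => [|u s IH] /=; first by rewrite muln0.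
move=> /andP[dk /IH]; rewrite mulnS expnD.
by move: (k ^ _) (k ^ N) (code N s) dk => K L c; nia.
Qed.

Lemma code_inj N s s' : size s = size s' -> all (fun v => v < k ^ N) s ->
  all (fun v => v < k ^ N) s' -> code N s = code N s' -> s = s'.
Proof.
elim: s s' => [|d s IH] [|d' s'] //= [ss] /andP[dk sk] /andP[dk' sk'].
have := code_lt sk; have := code_lt sk'; rewrite ss => h' h E.
have dE := congr1 (fun u => u %/ k ^ (N * size s')) E.
rewrite !divnMDl // !divn_small // !addn0 in dE.
by rewrite dE; move: E; rewrite dE => /addnI /IH ->.
Qed.

Lemma letter_code N s a : all (fun v => v < k ^ N) s ->
  letter (N * size s) (code N s) a = foldl (fun b v => letter N v b) a s.
Proof.
elim: s a => [|d s IH] a /=; first by rewrite muln0.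
by move=> /andP[dk sk]; rewrite mulnS letterD ?code_lt // IH.
Qed.

Lemma idempotent_iter (f : A -> A) :
  exists2 m, 0 < m & forall a, iter m f (iter m f a) = iter m f a.
Proof.
pose g (i : 'I_#|{ffun A -> A}|.+1) : {ffun A -> A} := [ffun a => iter i f a].
have /injectivePn[i [j ij /ffunP E]] : ~~ injectiveb g.
  by apply/negP => /injectiveP /leq_card; rewrite card_ord ltnn.
wlog lij : i j ij E / i < j.
  move=> H; have [/(H i j ij E)//|ji|ji] := ltngtP i j; last first.
    by move/val_inj/eqP: ji; rewrite (negPf ij).
  by apply: (H j i) => //; rewrite eq_sym.
have per t a : i <= t -> iter (t + (j - i)) f a = iter t f a.
  move=> /subnK <-; rewrite -addnA subnKC 1?ltnW // !iterD.
  by have := E a; rewrite !ffunE => ->.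
have perM u t a : i <= t -> iter (t + (j - i) * u) f a = iter t f a.
  move=> it; elim: u => [|u IH]; first by rewrite muln0 addn0.
  by rewrite mulnSr addnA per ?IH // (leq_trans it) ?leq_addr.
(* A multiple of the period [j - i] that exceeds the preperiod [i]. *)
exists ((j - i) * i.+1) => [|a]; first by rewrite muln_gt0 subn_gt0 lij.
by rewrite -iterD perM // (leq_trans (leqnSn i)) // leq_pmull // subn_gt0.
Qed.

(* Idempotence costs nothing: by [fork_idempotent] it can be achieved from any two
   positions at which [(a, b)] occurs in [(phi^N(a), phi^N(b))]. *)
Definition forked a b := a <> b /\ exists N U V,
  [/\ U < V, V < k ^ N, letter N U =1 letter N V,
     forall c, letter N U (letter N U c) = letter N U c
   & letter N U a = a /\ letter N U b = b].

(* The number of words of length [n] over [{w1, w2}] exceeds the number of self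
   maps of [A] for [n] large, so two of them act alike. *)
Lemma fork_idempotent N w1 w2 : w1 < k ^ N -> w2 < k ^ N -> w1 <> w2 ->
  exists N' U V, [/\ U < V, V < k ^ N', letter N' U =1 letter N' V,
    forall c, letter N' U (letter N' U c) = letter N' U c
  & forall B : A -> Prop, (forall a, B a -> B (letter N w1 a)) ->
      (forall a, B a -> B (letter N w2 a)) ->
      forall a, B a -> B (letter N' U a)].
Proof.
move=> w1k w2k w12; pose n := #|{ffun A -> A}|.
pose dig (b : bool) := if b then w1 else w2.
pose s (t : n.-tuple bool) := map dig t.
have szs t : size (s t) = n by rewrite size_map size_tuple.
have sk t : all (fun v => v < k ^ N) (s t).
  by apply/allP => d /mapP[[] _ ->].
pose g (t : n.-tuple bool) : {ffun A -> A} :=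
  [ffun a => letter (N * n) (code N (s t)) a].
have /injectivePn[t [t' tt' /ffunP E]] : ~~ injectiveb g.
  apply/negP => /injectiveP /leq_card; rewrite card_tuple card_bool.
  by apply/negP; rewrite -ltnNge ltn_expl.
have codeN : code N (s t) != code N (s t').
  apply: contra tt' => /eqP /code_inj;
    rewrite !szs => /(_ erefl (sk t) (sk t')).
  have dig_inj : injective dig by move=> [] [] //= e; case: w12; rewrite e.
  by move=> /(inj_map dig_inj) /val_inj ->.
wlog ltc : t t' tt' E codeN / code N (s t) < code N (s t').
  move=> H; have [/(H t t' tt' E codeN)//|ji|ji] :=
    ltngtP (code N (s t)) (code N (s t')); last by rewrite ji eqxx in codeN.
  by apply: (H t' t) => //; rewrite eq_sym.
have ck t0 : code N (s t0) < k ^ (N * n) by rewrite -[n in X in _ < X](szs t0)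
  code_lt.
(* Repeating each of the two codes [m] times keeps them distinct and in order, keeps their actions
   equal, and makes the common action idempotent. *)
have [m m0 idem] := idempotent_iter (letter (N * n) (code N (s t))).
exists (N * n * m), (centre (N * n) (code N (s t)) m),
  (centre (N * n) (code N (s t')) m); split.
- exact: centre_mono.
- exact: centre_lt.
- move=> a; rewrite !letter_centreE //; apply: eq_iter => c.
  by have := E c; rewrite !ffunE.
- by move=> c; rewrite !letter_centreE.
move=> B B1 B2 a Ba; rewrite letter_centreE //.
elim: {m0 idem} m => //= m; move: (iter _ _ _) => {Ba}a Ba.
rewrite -[n in letter (N * n)](szs t) letter_code //.
rewrite /s; elim: (tval t) a Ba => //= b u IH a Ba; apply: IH.
by case: b => /=; [apply: B1|apply: B2].
Qed.

Definition unforked c d :=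
  forall n i, ~ forked (letter n i c) (letter n i d).

Lemma unforked_refl c : unforked c c.
Proof. by move=> n i []. Qed.

Lemma unforked_sym c d : unforked c d -> unforked d c.
Proof.
move=> cd n i [ne [N [U [V [UV Vk E idem [e1 e2]]]]]]; apply: (cd n i).
by split; [exact: nesym|exists N, U, V].
Qed.

Lemma unforked_letter n i c d :
  unforked c d -> unforked (letter n i c) (letter n i d).
Proof. by move=> cd m j; rewrite !letter_comp; exact: cd. Qed.

(** If [g] is an idempotent of a fork fixing the images of [c] and [e], it sends the image of [d] to
    a letter [m] that it also fixes. Either image, if different from [m], would form with [m] a
    forked pair below [(c, d)] or [(d, e)]; hence both are [m]. *)
Lemma unforked_trans d c e : unforked c d -> unforked d e -> unforked c e.
Proof.
move=> cd de n i [ne [N [U [V [UV Vk E idem [e1 e2]]]]]]; apply: ne.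
set m := letter N U (letter n i d).
have -> : letter n i c = m.
  apply: contrapT => ne; apply: (@unforked_letter n i _ _ cd N U).
  by rewrite e1; split => //; exists N, U, V; split => //; split.
apply: contrapT => ne; apply: (@unforked_letter n i _ _ de N U).
by rewrite e2; split => //; exists N, U, V; split => //; split.
Qed.

(** The idempotent built from words over [w1] and [w2] keeps [c] in [B0] and [d] in [B1]. Their
    images are thus distinct, and fixed by idempotence: a forked pair below [(c, d)]. *)
Lemma unforked_one_return N w1 w2 (B0 B1 : A -> Prop) c d :
  w1 < k ^ N -> w2 < k ^ N -> w1 <> w2 ->
  (forall a, B0 a -> B0 (letter N w1 a)) ->
  (forall a, B0 a -> B0 (letter N w2 a)) ->
  (forall a, B1 a -> B1 (letter N w1 a)) ->
  (forall a, B1 a -> B1 (letter N w2 a)) ->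
  (forall a, B0 a -> B1 a -> False) -> B0 c -> B1 d -> ~ unforked c d.
Proof.
move=> w1k w2k ne p01 p02 p11 p12 dis c0 d1 cd.
have [N' [U [V [UV Vk E idem pres]]]] := fork_idempotent w1k w2k ne.
apply: (cd N' U); split; last by exists N', U, V; split => //; split.
by move=> e; apply: (dis (letter N' U d)); [rewrite -e|]; apply: pres.
Qed.

(** * Shattered sets under a class period *)

Definition class_period h := 0 < h /\ forall x (i : int), subshift phi x ->
  unforked (x i) (x (i + h%:Z)%R).

Lemma class_period_eqmod h x (i j : int) : class_period h -> subshift phi x ->
  (h%:Z %| (j - i)%R)%Z -> unforked (x i) (x j).
Proof.
move=> [h0 hE] Xx.
have H (i' : int) (n : nat) : unforked (x i') (x (i' + (n * h)%N%:Z)%R).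
  elim: n => [|n IH]; first by rewrite mul0n addr0; exact: unforked_refl.
  apply: unforked_trans IH _.
  have -> : (i' + (n.+1 * h)%N%:Z = i' + (n * h)%N%:Z + h%:Z)%R by lia.
  exact: hE.
move=> /dvdzP[q qE]; have [q0|q0] := lerP 0%R q.
  have -> : j = (i + (`|q|%N * h)%N%:Z)%R by nia.
  exact: H.
have -> : i = (j + (`|q|%N * h)%N%:Z)%R by nia.
exact/unforked_sym/H.
Qed.

Implicit Types (P : {set A} * {set A}) (Q : (int -> A) -> Prop) (S : seq int).

(** [Q] restricts the points that may realise the patterns, so that a case distinction on points
    becomes one on positions. *)
Definition shattered Q P S := forall s : int -> bool, exists x,
  [/\ subshift phi x, Q x &
      forall i, i \in S -> x i \in (if s i then P.2 else P.1)].

(** A pattern on [S1] that no point of [Q'] realises can be combined with any pattern on [S2]; the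
    points realising the combinations all lie outside [Q']. *)
Lemma shattered_cat Q Q' P S1 S2 : (forall i, i \in S1 -> i \notin S2) ->
  shattered Q P (S1 ++ S2) ->
  shattered (fun x => Q x /\ Q' x) P S1 \/
  shattered (fun x => Q x /\ ~ Q' x) P S2.
Proof.
move=> dis sh; have [|no] := pselect (shattered (fun x => Q x /\ Q' x) P S1).
  by left.
right=> s; have /existsNP[s1 s1P] := no.
have [x [Xx Qx xE]] := sh (fun i => if i \in S1 then s1 i else s i).
exists x; split=> //; last first.
  move=> i iS2; have := xE i; rewrite mem_cat iS2 orbT => /(_ isT).
  by case: (boolP (i \in S1)) => // iS1; move: (dis i iS1); rewrite iS2.
split=> // Q'x; apply: s1P; exists x; split => // i iS1.
by have := xE i; rewrite mem_cat iS1 => /(_ isT).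
Qed.

(** Each colour in turn is offered [t] fresh positions. If it does not shatter them, the remaining
    positions are shattered by points having another colour. *)
Lemma shattered_colour (C : finType) (Q' : C -> (int -> A) -> Prop) Q P S t :
  uniq S -> (forall x, subshift phi x -> Q x -> exists c, Q' c x) ->
  shattered Q P S -> #|C| * t <= size S ->
  exists c S', [/\ subseq S' S, size S' = t & shattered (Q' c) P S'].
Proof.
move=> uS cov; have {cov} : forall x, subshift phi x -> Q x ->
    exists2 c, c \in enum C & Q' c x.
  by move=> x Xx /(cov x Xx)[c Qc]; exists c => //; rewrite mem_enum.
rewrite cardE; elim: (enum C) Q S uS => [|c cs IH] Q S uS cov sh szS.
  have [x [Xx Qx _]] := sh (fun=> true).
  by have [c] := cov x Xx Qx.
have tS : t <= size S by rewrite (leq_trans _ szS) //= mulSn leq_addr.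
have : shattered Q P (take t S ++ drop t S) by rewrite cat_take_drop.
case/(@shattered_cat _ (Q' c)).
- move=> i it; apply/negP => id.
  move: uS; rewrite -(cat_take_drop t S) cat_uniq => /and3P[_ /hasPn/(_ i id)].
  by rewrite /= it.
- move=> shc; exists c, (take t S); split; rewrite ?take_subseq ?size_takel //.
  by move=> s; have [x [Xx [_ Qx] xE]] := shc s; exists x.
move=> /IH[|||c' [S' [S'S szS' sh']]].
- exact: drop_uniq.
- move=> x Xx [Qx nQ]; have [c' + Qc'] := cov x Xx Qx.
  by rewrite inE => /orP[/eqP e|c'cs]; [rewrite -e in nQ|exists c'].
- by rewrite size_drop leq_subRL // -mulSn.
by exists c', S'; split => //; apply: subseq_trans S'S (drop_subseq _ _).
Qed.

(** What [P] at position [i] of a block [phi^n(b)] requires of [b]. *)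
Definition preim_pair n i P : {set A} * {set A} :=
  ([set a | letter n i a \in P.1]%SET, [set a | letter n i a \in P.2]%SET).

Lemma preim_pair_comp n i m j P :
  preim_pair n i (preim_pair m j P) =
  preim_pair (n + m) (i * k ^ m + j %% k ^ m) P.
Proof. by congr pair; apply/setP => a; rewrite !inE letter_comp. Qed.

Definition reach P : {set {set A} * {set A}} :=
  [set P' | `[< exists n i, P' = preim_pair n i P >]]%SET.

Definition returns n i P := exists m j, preim_pair m j (preim_pair n i P) = P.

Lemma reachP P' P : P' \in reach P <-> exists n i, P' = preim_pair n i P.
Proof. by rewrite finset.in_set; split => /asboolP. Qed.

Lemma card_reach_lt n i P : ~ returns n i P ->
  #|reach (preim_pair n i P)| < #|reach P|.
Proof.
move=> nr; apply/proper_card/properP; split.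
  apply/fintype.subsetP => P' /reachP[m [j ->]]; apply/reachP.
  by exists (m + n), (j * k ^ n + i %% k ^ n); rewrite preim_pair_comp.
exists P.
  by apply/reachP; exists 0, 0; case: P {nr} => B0 B1; congr pair;
    apply/setP => a; rewrite !inE.
by apply/negP => /reachP[m [j /esym E]]; apply: nr; exists m, j.
Qed.

Definition disjoint_pair P := forall a, a \in P.1 -> a \in P.2 -> False.

(** Composing a loop through [r1] with one through [r2] in both orders gives two positions of one
    level that preserve [P.1] and [P.2]. Their residues mod [k ^ n] are [r1] and [r2], so
    [unforked_one_return] forces these to agree. *)
Lemma return_uniq n r1 r2 P c d : disjoint_pair P -> c \in P.1 ->
  d \in P.2 -> unforked c d -> r1 < k ^ n -> r2 < k ^ n ->
  returns n r1 P -> returns n r2 P -> r1 = r2.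
Proof.
move=> dis cP dP cd.
have loop r : r < k ^ n -> returns n r P -> exists N u,
    [/\ n <= N, u < k ^ N, u %% k ^ n = r & preim_pair N u P = P].
  move=> rk [m [j]]; rewrite preim_pair_comp modn_small // => jE.
  exists (m + n), (j %% k ^ m * k ^ n + r); split.
  - exact: leq_addl.
  - have : j %% k ^ m < k ^ m by rewrite ltn_mod.
    by rewrite expnD; move: (k ^ m) (k ^ n) (j %% _) rk => K L v; nia.
  - by rewrite modnMDl modn_small.
  - rewrite -[RHS]jE; congr pair; apply/setP => a; rewrite !inE;
      by rewrite !letterD // letter_mod.
move=> rk1 rk2 /(loop _ rk1)[N1 [u1 [nN1 uk1 um1 E1]]].
move=> /(loop _ rk2)[N2 [u2 [nN2 uk2 um2 E2]]].
have E12 : preim_pair (N2 + N1) (u2 * k ^ N1 + u1) P = P.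
  by have := preim_pair_comp N2 u2 N1 u1 P; rewrite modn_small // E1 E2.
have E21 : preim_pair (N2 + N1) (u1 * k ^ N2 + u2) P = P.
  by have := preim_pair_comp N1 u1 N2 u2 P; rewrite modn_small // E2 E1 addnC.
have [E|ne] := eqVneq (u2 * k ^ N1 + u1) (u1 * k ^ N2 + u2).
  have dv u N : n <= N -> u * k ^ N = 0 %[mod k ^ n].
    by move=> nN; rewrite mod0n -(subnK nN) expnD mulnA modnMl.
  have := congr1 (fun v => v %% k ^ n) E.
  by rewrite -modnDml dv // mod0n add0n um1 -modnDml dv // mod0n add0n um2.
exfalso; have inP (N u : nat) : preim_pair N u P = P ->
    (forall a, a \in P.1 -> letter N u a \in P.1) /\
    (forall a, a \in P.2 -> letter N u a \in P.2).
  by move=> E; split=> a; rewrite -{1}E inE.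
have [p1 p2] := inP _ _ E12; have [q1 q2] := inP _ _ E21.
apply: (@unforked_one_return (N2 + N1) _ _ (fun a => a \in P.1)
  (fun a => a \in P.2) c d _ _ _ p1 q1 p2 q2) => //.
- by rewrite expnD; move: (k ^ N1) (k ^ N2) uk1 uk2 => K L; nia.
- by rewrite expnD; move: (k ^ N1) (k ^ N2) uk1 uk2 => K L; nia.
- exact/eqP.
Qed.

Lemma pigeonhole_count (T : Type) (C : finType) (f : T -> C) (s : seq T) :
  0 < size s -> exists2 c, 0 < count (fun t => f t == c) s &
    size s <= #|C| * count (fun t => f t == c) s.
Proof.
move=> s0; have c0 : 0 < #|C|.
  by case: s s0 => // t s _; apply/card_gt0P; exists (f t).
have sE : size s = \sum_(c : C) count (fun t => f t == c) s.
  elim: s {s0} => [|t s IH] /=; first by rewrite big1.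
  rewrite big_split /= -IH (bigD1 (f t)) //= eqxx big1 // => c /negbTE.
  by rewrite eq_sym => ->.
have [c cE] := bigop.eq_bigmax (fun c => count (fun t => f t == c) s) c0.
have le : size s <= #|C| * count (fun t => f t == c) s.
  rewrite -cE [leqLHS]sE -sum_nat_const.
  by apply: leq_sum => i _; exact: bigop.leq_bigmax.
exists c => //; rewrite lt0n; apply: contraTneq s0 => c0'.
by move: le; rewrite c0' muln0 leqn0 -leqNgt leqn0.
Qed.

(** Take the first level at which every residue class holds at most half of [S]. One level coarser
    some class holds more than half, and one of its [k] subclasses has at least the fraction
    [1 / (2 k)] of [S]. *)
Lemma residue_split S : uniq S -> 1 < size S -> exists l s,
  let S2 := [seq t <- S | ((k ^ l)%:Z %| (t - s)%R)%Z] in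
  let S1 := [seq t <- S | ~~ ((k ^ l)%:Z %| (t - s)%R)%Z] in
  [/\ s \in S, size S <= 2 * k * size S2 & size S <= 2 * size S1].
Proof.
move=> uS S1; pose cl l s := count (fun t => ((k ^ l)%:Z %| (t - s)%R)%Z) S.
pose fine l := all (fun s => 2 * cl l s <= size S) S.
have ex : exists l, fine l.
  (* Distinct elements of [S] differ by at most [2 B < k ^ (2 B + 1)], so at this level all classes
     are singletons. *)
  pose B := \max_(s <- S) `|s|%N; exists B.*2.+1; apply/allP => s sS.
  suff -> : cl B.*2.+1 s = 1 by [].
  have := count_uniq_mem s uS; rewrite sS /= => <-;
    apply: eq_in_count => t tS /=.
  have [sB tB] : `|s|%N <= B /\ `|t|%N <= B.
    by split; rewrite /B; apply: (@bigop.leq_bigmax_seq _ S predT absz).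
  apply/idP/eqP => [/dvdzP[q qE]|->]; last by rewrite subrr dvdz0.
  have : B.*2.+1 < k ^ B.*2.+1 by exact: ltn_expl.
  move: (k ^ _) qE; clearbody B => K qE KB.
  have [->//|q0] := eqVneq t s.
  have : (q != 0)%R by apply: contra_neq q0 => q0; move: qE; rewrite q0; lia.
  by clear - qE KB sB tB; nia.
case: (ex_minnP ex) => -[/allP f0 _|l fl minl].
  have /hasP[s sS _] : has predT S by rewrite has_predT; exact: ltnW.
  have := f0 s sS; rewrite /cl (@eq_count _ _ predT) ?count_predT.
    by rewrite leqNgt -{1}[size S]mul1n ltn_mul2r (ltnW S1).
  by move=> t /=; rewrite expn0 dvd1z.
have : ~~ fine l by apply/negP => /minl; rewrite ltnn.
case/allPn => s sS; rewrite -ltnNge => sl.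
pose K := Posz (k ^ l).
have K0 : (K != 0)%R by rewrite /K; have := expk_gt0 l; lia.
pose f (t : int) : 'I_k := Ordinal (ltn_pmod `|(((t - s)%R %/ K)%Z %% Posz
  k)%Z|%N k_gt0).
pose S' := [seq t <- S | (K %| (t - s)%R)%Z].
have szS' : size S' = cl l s by rewrite size_filter.
have [|c c0 cE] := @pigeonhole_count _ _ f S'; first by rewrite szS'; lia.
rewrite card_ord in cE.
move: c0; rewrite -has_count => /hasP[s' + /eqP fs'].
rewrite mem_filter => /andP[Ks' s'S].
have clE : count (fun t => f t == c) S' <= cl l.+1 s'.
  rewrite count_filter /cl; apply: sub_count => t /= /andP[/eqP ft Kt].
  have [q qE] := dvdzP Ks'; have [q' qE'] := dvdzP Kt.
  move: ft fs'; rewrite /f qE qE' !mulzK // => <- /(congr1 val) /=.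
  have k0 : (Posz k != 0)%R by have := k_gt0; lia.
  have := modz_ge0 q k0; have := modz_ge0 q' k0.
  have := ltz_mod q k0; have := ltz_mod q' k0.
  move=> h1 h2 h3 h4; rewrite !modn_small; try lia.
  move=> E; have {}E : (q %% k = q' %% k)%Z by lia.
  apply/dvdzP; exists ((q' %/ k)%Z - (q %/ k)%Z)%R; rewrite expnSr PoszM -/K.
  have := divz_eq q k; have := divz_eq q' k; rewrite E.
  move: (q' %/ k)%Z (q %/ k)%Z (q' %% k)%Z => u v w e1 e2.
  have -> : (t - s' = (t - s) - (s' - s))%R by lia.
  by rewrite qE qE' e1 e2; lia.
exists l.+1, s'; split => //.
- rewrite size_filter -/(cl l.+1 s') -mulnA; apply: (@leq_trans (2 * cl l s)).
    exact: ltnW.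
  rewrite leq_mul2l /= -szS' (leq_trans cE) // leq_mul2l clE orbT //.
- have /allP/(_ _ s'S) le := fl.
  rewrite size_filter -(leq_add2l (2 * cl l.+1 s')) -mulnDr count_predC.
  by rewrite [leqRHS]mul2n -addnn leq_add2r.
Qed.

Lemma disjoint_preim_pair n i P :
  disjoint_pair P -> disjoint_pair (preim_pair n i P).
Proof. by move=> dis a; rewrite !inE; exact: dis. Qed.

Lemma shattered_inj P S (f : int -> int) :
  disjoint_pair P -> (forall s : int -> bool, exists2 x,
     subshift phi x & forall i, i \in S ->
     x (f i) \in (if s i then P.2 else P.1)) ->
  {in S &, injective f} /\ shattered (fun=> True) P (map f S).
Proof.
move=> dis sh; have finj : {in S &, injective f}.
  move=> i j iS jS fij; apply: contrapT => /eqP ij.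
  have [x _ xE] := sh (fun t => t == j).
  apply: (dis (x (f i))); first by have := xE i iS; rewrite (negPf ij).
  by rewrite fij; have := xE j jS; rewrite eqxx.
split=> // s; have [x Xx xE] := sh (s \o f); exists x; split => //.
by move=> _ /mapP[i iS ->]; exact: xE.
Qed.

(* Induction on the number of pairs reachable from [P]. Split [S] along a residue
   class mod [k ^ l] of moderate size and desubstitute [l] times: either the pair
   seen by that class never returns to [P], and is then simpler, or it does, which
   determines the residue of the point and makes the pairs seen by all the other
   positions simpler. *)
Lemma shattered_bounded h P : class_period h -> disjoint_pair P ->
  exists M, forall S, uniq S -> shattered (fun=> True) P S -> size S <= M.
Proof.
move=> hE; have [h0 _] := hE.
have [m] := ubnP #|reach P|; elim: m P => // m IH P Pm dis.
have [[c [d [cP dP cd]]]|dead] := pselect (exists c d,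
    [/\ c \in P.1, d \in P.2 & unforked c d]); last first.
  (* Positions congruent mod [h] carry unforked letters, which here never lie one in [P.1] and the
     other in [P.2]; each class mod [h] meets [S] at most once. *)
  exists h => S uS sh; rewrite leqNgt; apply/negP => hS.
  pose f (t : int) : 'I_h := Ordinal (ltn_pmod `|(t %% Posz h)%Z|%N h0).
  have [|u _ uE] := @pigeonhole_count _ _ f S; first by case: size hS.
  rewrite card_ord -size_filter in uE.
  have u1 : 1 < size [seq t <- S | f t == u].
    by have := leq_trans hS uE; rewrite -[X in X < _]muln1 ltn_pmul2l.
  move: u1; set S' := seq.filter _ _ => u1.
  have uS' : uniq S' by exact: filter_uniq.
  have ne : nth 0%R S' 0 != nth 0%R S' 1 by rewrite nth_uniq // ltnW.
  have /(mem_nth 0%R) := u1; have /(mem_nth 0%R) := ltnW u1.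
  move: (nth _ _ _) (nth _ _ _) ne => s t st.
  rewrite eq_sym in st;
    rewrite !mem_filter => /andP[/eqP ft tS] /andP[/eqP fs sS].
  have [x [Xx _ xE]] := sh (fun i => i == t).
  apply: dead; exists (x s), (x t); split.
  - by have := xE s sS; rewrite (negPf st).
  - by have := xE t tS; rewrite eqxx.
  apply: (class_period_eqmod hE Xx); move: ft; rewrite -fs => /(congr1 val) /=.
  have h0' : (Posz h != 0)%R by lia.
  have := modz_ge0 s h0'; have := modz_ge0 t h0'.
  have := ltz_mod s h0'; have := ltz_mod t h0'.
  move=> h1 h2 h3 h4; rewrite !modn_small; try lia.
  move=> E; apply/dvdzP; exists ((t %/ h)%Z - (s %/ h)%Z)%R.
  have := divz_eq t h; have := divz_eq s h; lia.
have /choice[f fP] P' : exists M, #|reach P'| < #|reach P| ->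
    disjoint_pair P' -> forall S, uniq S -> shattered (fun=> True) P' S ->
    size S <= M.
  have [lt|] := ltnP #|reach P'| #|reach P|; last by exists 0.
  have [d'|] := pselect (disjoint_pair P'); last by exists 0.
  have [|M HM] := IH P' _ d'; first exact: leq_trans lt Pm.
  by exists M.
pose Mx := \max_P' f P'; pose C := ({set A} * {set A})%type.
have lower n r S : ~ returns n r P -> uniq S ->
    shattered (fun=> True) (preim_pair n r P) S -> size S <= Mx.
  move=> /card_reach_lt lt uS sh;
    apply: leq_trans (bigop.leq_bigmax (preim_pair n r P)).
  by apply: fP => //; exact: disjoint_preim_pair.
exists (2 * k * (#|{: C}| * Mx.+1)).+1 => S uS sh; rewrite leqNgt;
  apply/negP => big.
have [|l [s []]] := residue_split uS; first exact: leq_ltn_trans big.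
set S2 := seq.filter _ S; set S1 := seq.filter _ S => sS big2 big1.
have X2 : #|{: C}| * Mx.+1 <= size S2.
  have := ltn_trans (leqnn _) (leq_trans big big2).
  by move/ltnW; rewrite leq_pmul2l // muln_gt0 k_gt0.
have X1 : #|{: C}| * Mx.+1 <= size S1.
  have := ltn_trans (leqnn _) (leq_trans big big1).
  move/ltnW; rewrite -mulnA leq_pmul2l // => /(leq_trans _); apply.
  by rewrite leq_pmull ?k_gt0.
have C0 : 0 < #|{: C}| by apply/card_gt0P; exists P.
have K0 : (Posz (k ^ l) != 0)%R by have := expk_gt0 l; lia.
pose pos (i r : int) := `|((i + r)%R %% Posz (k ^ l))%Z|%N.
have posk i r : pos i r < k ^ l.
  by have := modz_ge0 (i + r)%R K0; have := ltz_mod (i + r)%R K0;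
    rewrite /pos; lia.
have posE i r : (i + r = ((i + r)%R %/ Posz (k ^ l))%Z * Posz (k ^ l) + Posz
  (pos i r))%R.
  rewrite {1}(divz_eq (i + r)%R (Posz (k ^ l))); congr (_ + _)%R.
  by have := modz_ge0 (i + r)%R K0; rewrite /pos; lia.
(* The points for which the pair seen from [s] returns to [P], in some desubstitution. *)
pose Q' (x : int -> A) := exists r y, [/\ subshift phi y,
  forall i, i \in S -> x i = inflate l r y i & returns l (pos s r) P].
have {}sh : shattered (fun=> True) P (S1 ++ S2).
  move=> v; have [x [Xx _ xE]] := sh v; exists x; split => // i.
  by rewrite mem_cat !mem_filter -andb_orl => /andP[_]; exact: xE.
have dis12 i : i \in S1 -> i \notin S2.
  by rewrite !mem_filter => /andP[/negPf ->].
case: (shattered_cat Q' dis12 sh) => {}sh.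
  (* By [return_uniq] the residue of [s] is forced, so the [r0] of one point describes the block
     structure of all. Positions of [S1] have other residues and do not return; the pigeonhole
     principle selects those that see one common pair. *)
  have [x0 [_ [_ [r0 [_ [_ _ ret0]]]] _]] := sh (fun=> true).
  pose lab i : C := preim_pair l (pos i r0) P.
  have [|P' cnt0 cntE] := pigeonhole_count lab (s := S1).
    by apply: leq_trans X1; rewrite muln_gt0 C0.
  have {cntE} big' := leq_trans X1 cntE; rewrite leq_pmul2l // in big'.
  rewrite -size_filter in big' cnt0; move: big' cnt0;
    set S1' := seq.filter _ S1 => big' cnt0.
  have labE i : i \in S1' -> i \in S1 /\ lab i = P'.
    by rewrite mem_filter => /andP[/eqP].
  have nret i : i \in S1 -> ~ returns l (pos i r0) P.
    rewrite mem_filter => /andP[/negP + _] ret; apply.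
    have E := return_uniq dis cP dP cd (posk _ _) (posk _ _) ret ret0.
    apply/dvdzP; exists (((i + r0)%R %/ Posz (k ^ l))%Z - ((s + r0)%R %/ Posz
      (k ^ l))%Z)%R.
    by have := posE i r0; have := posE s r0; rewrite E; lia.
  have [i iS1'] : exists i, i \in S1'.
    by case: S1' cnt0 {labE big'} => // i ? _; exists i; exact: mem_head.
  have [iS1 iE] := labE i iS1'.
  have P'dis : disjoint_pair P' by rewrite -iE; exact: disjoint_preim_pair.
  have := @shattered_inj P' S1' (fun j => ((j + r0)%R %/ Posz (k ^ l))%Z) P'dis.
  case=> [v|finj sh'].
    have [x [Xx [_ [r [y [Xy xE ret]]]] xv]] := sh v.
    have E := return_uniq dis cP dP cd (posk _ _) (posk _ _) ret ret0.
    pose q := (((s + r)%R %/ Posz (k ^ l))%Z - ((s + r0)%R %/ Posz (k ^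
      l))%Z)%R.
    exists (shift_by q y); first exact/subshift_shift_by.
    move=> j /labE[jS1 jE]; have := xv j jS1.
    rewrite xE; last by move: jS1; rewrite mem_filter => /andP[].
    have -> : r = (r0 + q * Posz (k ^ l))%R.
      by have := posE s r; have := posE s r0; rewrite E /q; lia.
    rewrite -inflate_shift_by (inflateE _ (posk j r0) (posE j r0)) -jE.
    by case: (v j); rewrite /lab /= inE.
  have uf : uniq (map (fun j => ((j + r0)%R %/ Posz (k ^ l))%Z) S1').
    by rewrite map_inj_in_uniq // !filter_uniq.
  have := lower l (pos i r0) _ (nret i iS1) uf.
  by rewrite -/(lab i) iE => /(_ sh'); rewrite size_map leqNgt big'.
pose e i := ((i - s)%R %/ Posz (k ^ l))%Z.
have eE i : i \in S2 -> (i = s + e i * Posz (k ^ l))%R.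
  rewrite mem_filter => /andP[/dvdzP[q qE] _]; rewrite /e qE mulzK //; lia.
(* Positions of [S2] are congruent to [s], so in a given point they all see the same pair. The
   residue may vary with the point; the pair, one of finitely many, serves as its colour. *)
pose Q'' (c' : C) x := exists r y, [/\ subshift phi y, c' = preim_pair l r P,
  ~ returns l r P & forall i, i \in S2 -> x i = letter l r (y (e i))].
have [|x Xx [_ nQ]|P' [S2' [S2'S szS2' sh']]] :=
    shattered_colour (Q' := Q'') _ _ sh X2.
- exact: filter_uniq.
- have [r [y [rk Xy xE]]] := desubstitute l (\max_(i <- S) `|i|%N) Xx.
  have xE' i : i \in S -> x i = inflate l r y i.
    by move=> iS; apply/xE/(@bigop.leq_bigmax_seq _ S predT absz).
  exists (preim_pair l (pos s r) P), (pos s r).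
  exists (shift_by ((s + Posz r)%R %/ Posz (k ^ l))%Z y); split => //.
  + exact/subshift_shift_by.
  + by move=> ret; apply: nQ; exists (Posz r), y.
  + move=> i iS2; rewrite xE'; last by move: iS2; rewrite mem_filter => /andP[].
    by apply: inflateE => //; have := posE s r; have := eE i iS2; lia.
have [x0 [_ [r0 [y0 [_ P'E nret _]]] _]] := sh' (fun=> true).
have P'dis : disjoint_pair P' by rewrite P'E; exact: disjoint_preim_pair.
have := @shattered_inj P' S2' e P'dis.
case=> [v|finj sh''].
  have [x [_ [r [y [Xy PE _ xE]]] xv]] := sh' v; exists y => // j jS.
  have := xv j jS; rewrite (xE j (mem_subseq S2'S jS)) PE.
  by case: (v j); rewrite inE.
have uf : uniq (map e S2').
  by rewrite map_inj_in_uniq // (subseq_uniq S2'S) // filter_uniq.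
have := lower l r0 _ nret uf; rewrite -P'E => /(_ sh'').
by rewrite size_map szS2' ltnn.
Qed.

(** * Independence from a forked pair *)

Definition no_class_period := forall h, 0 < h -> exists x (i : int),
  subshift phi x /\ ~ unforked (x i) (x (i + h%:Z)%R).

Lemma forked_not_unforked c d : ~ unforked c d -> exists n i,
  i < k ^ n /\ forked (letter n i c) (letter n i d).
Proof.
move=> /existsNP[n /existsNP[i /contrapT H]]; exists n, (i %% k ^ n).
by rewrite !letter_mod ltn_mod.
Qed.

(* [h] is a multiple of [V - U] for one choice of witnesses [(N, U, V)] of each
   forked pair. A pair of letters at distance [h] that leads to the forked pair
   [(a, b)] then forces, for [g = letter N U], two positions at distance [V - U]
   on which [g] takes different values. *)
Lemma forked_step : no_class_period -> exists N U V y (t : int) a,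
  [/\ U < V, V < k ^ N, letter N U =1 letter N V,
      forall c, letter N U (letter N U c) = letter N U c
    & [/\ subshift phi y, letter N U a = a &
       letter N U (y t) <> letter N U (y (t + (V - U)%N%:Z)%R)]].
Proof.
move=> bad; have /choice[f fP] (t : A * A) : exists w : nat * nat * nat,
    forked t.1 t.2 ->
    [/\ w.1.2 < w.2, w.2 < k ^ w.1.1, letter w.1.1 w.1.2 =1 letter w.1.1 w.2,
     forall c, letter w.1.1 w.1.2 (letter w.1.1 w.1.2 c) = letter w.1.1 w.1.2 c
     & letter w.1.1 w.1.2 t.1 = t.1 /\ letter w.1.1 w.1.2 t.2 = t.2].
  have [[_ [N [U [V H]]]]|no] := pselect (forked t.1 t.2).
    by exists (N, U, V).
  by exists (0, 0, 0).
pose E t := maxn 1 ((f t).2 - (f t).1.2).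
have E0 : 0 < \prod_t E t by apply: prodn_gt0 => t; rewrite leq_maxl.
have [x [i [Xx nu]]] := bad _ E0.
have [n [j [jk fk]]] := forked_not_unforked nu.
pose y := inflate n 0%R x; pose a := letter n j (x i).
pose b := letter n j (x (i + (\prod_t E t)%:Z)%R).
have := fP (a, b) fk; move: (E0) => h0.
have : E (a, b) %| \prod_t E t by rewrite (bigD1 (a, b)) //= dvdn_mulr.
rewrite /E; case: (f (a, b)) => [[N U] V] /= Eh [UV Vk gE idem [ga gb]].
have {Eh} /dvdnP[q qE] : V - U %| \prod_t E t.
  by move: Eh; rewrite (maxn_idPr _) // subn_gt0.
pose t0 := (i * (k ^ n)%:Z + j%:Z)%R; pose D := ((V - U)%N%:Z)%R.
have ya : y t0 = a by apply: inflateE; rewrite ?addr0.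
have yb : y (t0 + (q * k ^ n)%N%:Z * D)%R = b.
  apply: inflateE => //; rewrite addr0 /t0 /D.
  by move: qE; rewrite /E; move: (\prod_t _) => h ->; lia.
(* Otherwise [g] would be constant along the progression of step [D] from [a] to [b], although it
   fixes both. *)
have [s sE] : exists s, letter N U (y (t0 + s%:Z * D)%R) <>
    letter N U (y (t0 + s.+1%:Z * D)%R).
  apply: contrapT => no; case: fk => ne _; apply: ne; rewrite -/a -/b -ga -gb.
  rewrite -ya -yb; elim: (q * k ^ n) => [|s IH]; first by rewrite mul0r addr0.
  by rewrite IH; apply: contrapT => ne; apply: no; exists s.
exists N, U, V, y, (t0 + s%:Z * D)%R, a; split=> //; split => //.
  exact: subshift_inflate.
by move=> e; apply: sE; rewrite e; congr (letter N U (y _)); rewrite /D; lia.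
Qed.

(** [J0] and [J1] end at two letters at distance [V - U] in [phi^M(z)], projected by [g] to distinct
    fixed letters. [I0] and [I1] use [U] and [V] as their digit of the same weight, whence
    [I1 - I0 = J1 - J0]. *)
Lemma forked_pattern : no_class_period -> exists L I0 I1 J0 J1 z c d,
  [/\ [/\ I0 < I1, I1 < k ^ L, J0 < k ^ L, J1 < k ^ L & I0 + J1 = I1 + J0],
    c <> d,
    forall e, e \in [:: z; c; d] -> letter L I0 e = e /\ letter L I1 e = e,
    letter L J0 z = c & letter L J1 z = d].
Proof.
move=> /forked_step[N [U [V [y [t [z [UV Vk gE idem [Xy gz ne]]]]]]]].
have N0 : 0 < N by case: N Vk {gE idem gz ne} => //; rewrite expn0; case: V UV.
have Uk := ltn_trans UV Vk.
have [n0 H] := window_in_power z t (V - U).+1 Xy.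
pose M := N * n0 + N; have n0M : n0 <= M.
  by rewrite (leq_trans _ (leq_addr _ _)) // leq_pmull.
have [p pk pE] := H M n0M.
pose m := centre N U n0; have mk : m < k ^ (N * n0) by exact: centre_lt.
have fixm e : letter N U e = e -> letter (N * n0) m e = e.
  by move=> ge; rewrite letter_centreE //;
    elim: n0 {H M n0M pk pE m mk} => //= n ->.
exists (M + N), ((m * k ^ N + U) * k ^ N + U), ((m * k ^ N + V) * k ^ N + U).
exists (p * k ^ N + U), ((p + (V - U)) * k ^ N + U), z.
exists (letter N U (y t)), (letter N U (y (t + (V - U)%N%:Z)%R)).
have K0 := expk_gt0 N.
split=> //.
- rewrite /M !expnD; move: pk; rewrite /M expnD.
  move: (k ^ (N * n0)) (k ^ N) mk Uk Vk K0 => K J.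
  move=> mk Uk Vk K0 pk; split; nia.
- move=> e eI; have ge : letter N U e = e.
    by move: eI; rewrite !inE => /or3P[] /eqP ->.
  by rewrite /M !letterD // -gE fixm // ge.
- by have := pE 0 isT; rewrite addr0 addn0 => ->; rewrite letterD.
- by rewrite pE // letterD.
Qed.

(** The base [k ^ L] digits of the origin [q] are [I0] or [I1], as [s] prescribes. Exchanging the
    digit of scale [l] for [J0] or [J1] moves the position by the same amount in both cases; higher
    digits fix [z], the new one turns it into [c] or [d], and lower digits preserve that. *)
Lemma forked_independence L I0 I1 J0 J1 z c d : I0 < k ^ L -> I1 < k ^ L ->
  J0 < k ^ L -> J1 < k ^ L -> I0 + J1 = I1 + J0 ->
  (forall e, e \in [:: z; c; d] -> letter L I0 e = e /\ letter L I1 e = e) ->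
  letter L J0 z = c -> letter L J1 z = d ->
  forall (s : nat -> bool) m, exists2 x, subshift phi x & forall l, l < m ->
    x ((J0%:Z - I0%:Z) * (k ^ (L * l))%:Z)%R = if s l then d else c.
Proof.
move=> I0k I1k J0k J1k IJ fixe J0z J1z s m.
have [q [qk qe qE]] : exists q, [/\ q < k ^ (L * m),
    forall e, e \in [:: z; c; d] -> letter (L * m) q e = e
  & forall l, l < m -> exists u, [/\ u < k ^ (L * m),
      Posz u = (q%:Z + (J0%:Z - I0%:Z) * (k ^ (L * l))%:Z)%R &
      letter (L * m) u z = if s l then d else c]].
  elim: m => [|m [q [qk qe qE]]]; first by exists 0; rewrite muln0.
  have zI : z \in [:: z; c; d] by rewrite mem_head.
  pose D := if s m then I1 else I0; pose D' := if s m then J1 else J0.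
  have Dk : D < k ^ L by rewrite /D; case: ifP.
  have D'k : D' < k ^ L by rewrite /D'; case: ifP.
  have DD : (D'%:Z - D%:Z = J0%:Z - I0%:Z)%R by rewrite /D /D'; case: ifP; lia.
  have De e : e \in [:: z; c; d] -> letter L D e = e.
    by move=> /fixe[]; rewrite /D; case: ifP.
  have lt u v : u < k ^ L -> v < k ^ (L * m) ->
    u * k ^ (L * m) + v < k ^ (L * m.+1).
    by rewrite mulnS expnD; move: (k ^ _) (k ^ L) => K J; nia.
  exists (D * k ^ (L * m) + q); split; first exact: lt.
    by move=> e eI; rewrite mulnS letterD // De // qe.
  move=> l; rewrite ltnS leq_eqVlt => /orP[/eqP ->|/qE[u [uk uE us]]].
    exists (D' * k ^ (L * m) + q); split; first exact: lt.
      by rewrite -DD; lia.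
    rewrite mulnS letterD //.
    have -> : letter L D' z = if s m then d else c by rewrite /D'; case: ifP.
    by apply: qe; rewrite !inE; case: ifP; rewrite eqxx !orbT.
  exists (D * k ^ (L * m) + u); split; first exact: lt.
    by rewrite PoszD uE; lia.
  by rewrite mulnS letterD // De.
have [x Xx xE] := word_in_point (L * m) q z; exists x => // l /qE[u [uk uE us]].
by rewrite xE -uE // ltz_nat.
Qed.

Lemma forked_independent_points : no_class_period -> exists x0 x1,
  [/\ subshift phi x0, subshift phi x1, x0 0%R <> x1 0%R & forall n : nat,
    exists2 f : nat -> int, injective f & forall (s : nat -> bool) m,
      exists2 x, subshift phi x & forall l (i : int), l < m -> `|i|%N <= n ->
        x (f l + i)%R = (if s l then x1 else x0) i].
Proof.
move=> /forked_pattern[L [I0 [I1 [J0 [J1 [z [c [d]]]]]]]].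
move=> [[I01 I1k J0k J1k IJ] cd fixe J0z J1z].
have I0k := ltn_trans I01 I1k.
(* Both digits fix [c] and [d], and [I0 < I1] keeps [p] away from the two ends of the block. *)
pose p := I0 * k ^ L + I1; pose N := L + L.
have p0 : 0 < p by rewrite /p addn_gt0 (leq_ltn_trans _ I01) ?orbT.
have pk : p.+1 < k ^ N.
  by rewrite /p /N expnD; move: (k ^ L) I01 I1k => K; clear; nia.
have fixp e : e \in [:: z; c; d] -> letter N p e = e.
  by move=> eI; have [E1 E2] := fixe e eI; rewrite /N /p letterD // E1.
have [|x0 X0 x0E] := limit_point p0 pk (a := c).
  by apply: fixp; rewrite !inE eqxx orbT.
have [|x1 X1 x1E] := limit_point p0 pk (a := d).
  by apply: fixp; rewrite !inE eqxx !orbT.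
exists x0, x1; split=> //.
  have in0 : in_centre N p 0 0%R by rewrite /in_centre muln0.
  by rewrite (x0E 0) // (x1E 0) // muln0.
move=> n; have [c1 c2] := centre_bounds n.+1 p0 pk.
pose C := centre N p n.+1; pose M := N * n.+1.
have inC i : `|i|%N <= n -> in_centre N p n.+1 i.
  by rewrite /in_centre; clear - c1 c2; lia.
exists (fun l => (J0%:Z - I0%:Z) * (k ^ (L * l))%:Z * (k ^ M)%:Z)%R.
  have JI : J0 <> I0.
    move=> e; apply: cd; have zI : z \in [:: z; c; d] by rewrite mem_head.
    have [z1 z2] := fixe z zI.
    have e' : J1 = I1 by lia.
    by rewrite -J0z -J1z e e' z1 z2.
  have k1 : 1 < k ^ L by rewrite (leq_ltn_trans _ I1k) // (leq_ltn_trans _ I01).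
  have JI0 : (J0%:Z - I0%:Z != 0)%R by lia.
  have M0 : ((k ^ M)%:Z != 0)%R by have := expk_gt0 M; lia.
  move=> l l' /(mulIf M0) /(mulfI JI0) [] /eqP; rewrite !expnM.
  by rewrite eqn_exp2l // => /eqP.
move=> s m; have [x Xx xE] := forked_independence I0k I1k J0k J1k IJ fixe J0z
  J1z s m.
exists (inflate M C%:Z x); first exact: subshift_inflate.
move=> l i lm /inC iC; have [iC0 iC1] := iC.
rewrite (@inflateE _ _ _ ((J0%:Z - I0%:Z) * (k ^ (L * l))%:Z)%R _ `|(C%:Z +
  i)%R|%N).
- by rewrite xE //; case: ifP => _; rewrite ?(x1E _ _ iC) ?(x0E _ _ iC).
- by move: iC0 iC1; rewrite -/C -/M; lia.
- by move: iC0; rewrite -/C; lia.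
Qed.

(** * Recognizability *)

(** The finite form of compactness behind all passages from windows to whole points. *)
Lemma uniform_colour (I : finType) (Q : I -> nat -> Prop) :
  (forall c l l', l <= l' -> Q c l' -> Q c l) ->
  (forall l, exists c, Q c l) -> exists c, forall l, Q c l.
Proof.
move=> mono H; apply: contrapT => no.
have /choice[f fP] (c : I) : exists l, ~ Q c l.
  by apply/existsNP => Qc; apply: no; exists c.
have [c Qc] := H (\max_c f c).
by apply: (fP c); apply: mono Qc; exact: bigop.leq_bigmax.
Qed.

Lemma uniform_index n (Q : nat -> nat -> Prop) :
  (forall r l l', l <= l' -> Q r l' -> Q r l) ->
  (forall l, exists2 r, r < n & Q r l) -> exists2 r, r < n & forall l, Q r l.
Proof.
move=> mono H; have [||r Qr] := @uniform_colour 'I_n (fun r => Q r).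
- by move=> r; exact: mono.
- by move=> l; have [r rn Qr] := H l; exists (Ordinal rn).
- by exists r.
Qed.

Lemma inflateD n r t y i : inflate n (r + t)%R y i = inflate n r y (i + t)%R.
Proof. by rewrite /inflate addrA addrAC. Qed.

Lemma eq_inflate n r x y i :
  (forall q : int, `|q|%N <= `|(i + r)%R|%N -> x q = y q) ->
  inflate n r x i = inflate n r y i.
Proof.
move=> xy; have [q [j [jk E]]] := pos_decomp n (i + r)%R.
rewrite !(inflateE _ jk E) xy // E; have := expk_gt0 n.
by move: (k ^ n) jk => K; clear; nia.
Qed.

(* [T^e(phi^n(X))] and [phi^n(X)] coincide up to [unforked]. *)
Definition overlap n (e : int) := forall l : nat, exists y y',
  [/\ subshift phi y, subshift phi y' & forall j : int, `|j|%N <= l ->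
    unforked (inflate n 0 y j) (inflate n e y' j)].

(** By recurrence, a long enough window of one coincidence shows every word of [y]. Overlaps can
    therefore be chained, which makes those of a given level a subgroup of the integers. *)
Lemma overlap_all n e l y : overlap n e -> subshift phi y ->
  exists2 y', subshift phi y' & forall j : int, `|j|%N <= l ->
    unforked (inflate n 0 y j) (inflate n e y' j).
Proof.
move=> oe Xy; have [n2 R] := linear_recurrence.
pose B := 2 * k ^ (n2 + l.*2.+1).
have [y1 [y1' [Xy1 Xy1' E]]] := oe (l + (B + l) * k ^ n).
have [s [sB sE]] := R l.*2.+1 y1 y (- l%:Z)%R 0%R Xy1 Xy.
have lk : l.*2 < k ^ l.*2.+1 by rewrite ltnW // ltn_expl.
pose t : int := (s%:Z + l%:Z)%R.
exists (shift_by t y1') => [|j jl]; first exact/subshift_shift_by.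
have -> : inflate n 0 y j = inflate n 0 (shift_by t y1) j.
  apply: eq_inflate => q; rewrite addr0 => qj.
  have -> : y q = y (- l%:Z + `|(q + l%:Z)%R|%N%:Z)%R by congr y; lia.
  rewrite -sE; last by lia.
  by rewrite /shift_by /t; congr y1; lia.
rewrite !inflate_shift_by !inflateD; apply: E.
rewrite /t /B; move: sB; rewrite -/B; move: (k ^ n) (k ^ l.*2.+1) => K K' sB.
have : (`|(j + (s%:Z + l%:Z) * K%:Z)%R| <= `|j| + (s + l) * K)%N by clear; nia.
move=> /leq_trans; apply; rewrite leq_add // leq_mul2r; apply/orP; right.
by rewrite leq_add2r (leq_trans _ sB) // leq_addr.
Qed.

Lemma overlapD n e f : overlap n e -> overlap n f -> overlap n (e + f)%R.
Proof.
move=> oe oF l; have [y [_ [Xy _ _]]] := oe 0.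
have [y1 Xy1 E1] := overlap_all l oe Xy.
have [y2 Xy2 E2] := overlap_all (l + `|e|%N) oF Xy1.
exists y, y2; split=> // j jl; apply: unforked_trans (E1 j jl) _.
rewrite addrC inflateD -[e in inflate _ e]add0r inflateD.
by apply: E2; lia.
Qed.

Lemma overlapN n e : overlap n e -> overlap n (- e)%R.
Proof.
move=> oe l; have [y [y' [Xy Xy' E]]] := oe (l + `|e|%N).
exists y', y; split=> // j jl; apply: unforked_sym.
have <- : inflate n 0 y (j - e)%R = inflate n (- e)%R y j.
  by rewrite /inflate addr0.
have <- : inflate n e y' (j - e)%R = inflate n 0 y' j.
  by rewrite /inflate subrK addr0.
by apply: E; lia.
Qed.

Lemma overlap_gcd n e f : overlap n e -> overlap n f -> overlap n (gcdz e f).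
Proof.
move=> oe oF; have [u [v <-]] := Bezoutz e f.
have mul (z g : int) : overlap n g -> overlap n (z * g)%R.
  move=> og; have nat (m : nat) : overlap n (m%:Z * g)%R.
    elim: m => [|m IH]; last first.
      have -> : (m.+1%:Z * g = m%:Z * g + g)%R by lia.
      exact: overlapD.
    have [y [_ [Xy _ _]]] := og 0; move=> l; exists y, y; split=> // j _.
    by rewrite mul0r; exact: unforked_refl.
  have [z0|z0] := lerP 0%R z.
    have -> : z = `|z|%N%:Z%R by lia.
    exact: nat.
  have -> : (z * g = - (`|z|%N%:Z * g))%R by nia.
  exact/overlapN/nat.
by apply: overlapD; exact: mul.
Qed.

Lemma overlap_expk n : (exists x, subshift phi x) -> overlap n (k ^ n)%:Z%R.
Proof.
move=> [y Xy] l; exists y, (shift_by (- 1)%R y); split=> //.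
  exact/subshift_shift_by.
by move=> j _; rewrite inflate_shift_by mulN1r subrr; exact: unforked_refl.
Qed.

Lemma overlapS n e : overlap n e -> overlap n.+1 (k%:Z * e)%R.
Proof.
move=> oe l; have [y [y' [Xy Xy' E]]] := oe l.
exists y, y'; split=> // j jl; rewrite -addn1 -!inflate_inflate.
have [q [r [rk jE]]] := pos_decomp 1 j.
rewrite (@inflateE 1 0%R _ q _ r) ?addr0 //.
rewrite (@inflateE 1 _ _ (q + e)%R _ r) //; last by rewrite jE expn1; lia.
rewrite -inflateD add0r; apply/unforked_letter/E.
by move: jE rk; rewrite expn1; nia.
Qed.

(** Apply the level 1 overlap to a point of [phi^n(X)] and desubstitute its partner [n] times; the
    residue [r] found there becomes a shift by [k * r] under [phi]. *)
Lemma overlap_lift n e : overlap 1 e ->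
  exists i : int, overlap n.+1 (e + k%:Z * i)%R.
Proof.
move=> oe; have [y0 [_ [Xy0 _ _]]] := oe 0.
have Xz := @subshift_inflate n 0%R y0 Xy0.
pose Q r l := exists y y', [/\ subshift phi y, subshift phi y' &
  forall j : int, `|j|%N <= l ->
    unforked (inflate n.+1 0 y j) (inflate n.+1 (e + k%:Z * r%:Z) y' j)].
have [||r _ Qr] := @uniform_index (k ^ n) Q.
- move=> r l l' ll' [y [y' [Xy Xy' E]]]; exists y, y'; split=> // j jl.
  by apply: E; exact: leq_trans jl ll'.
- move=> l; have [z' Xz' E] := overlap_all l oe Xz.
  have [r [y' [rk Xy' zE]]] := desubstitute n (l + `|e|%N) Xz'.
  exists r => //; exists y0, y'; split=> // j jl.
  have := E j jl; rewrite inflate_inflate addn1.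
  have -> // : inflate 1 e z' j = inflate n.+1 (e + k%:Z * r%:Z)%R y' j.
  have -> : inflate 1 e z' j = inflate 1 e (shift_by r%:Z (inflate n 0 y')) j.
    apply: eq_inflate => q qj; rewrite zE; last by lia.
    by rewrite /shift_by -inflateD add0r.
  by rewrite inflate_shift_by inflate_inflate addn1 expn1 mulrC.
by exists r%:Z%R.
Qed.

(** [g1 = gcd(e, k)] is a proper divisor of [k]. If [g] overlaps at one level, then [k * g] and some
    [g1 + k * i] overlap at the next; their gcd [g'] satisfies [gcd(g', k) %| g1] and
    [g' %| gcd(g', k) * g], so [g' <= g1 * g]. *)
Lemma overlap_small e : 0 < e -> e < k -> overlap 1 e%:Z%R ->
  exists2 g1, 2 * g1 <= k & forall n, exists g,
    [/\ 0 < g, g <= g1 ^ n.+1 & overlap n.+1 g%:Z%R].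
Proof.
move=> e0 ek oe; have [y0 [_ [Xy0 _ _]]] := oe 0.
pose g1 := gcdn e k.
have g10 : 0 < g1 by rewrite gcdn_gt0 e0.
have o1 : overlap 1 g1%:Z%R.
  have := overlap_gcd oe (@overlap_expk 1 (ex_intro _ y0 Xy0)).
  by rewrite /gcdz /= expn1.
exists g1.
  have /dvdnP[q qE] : g1 %| k by exact: dvdn_gcdr.
  have : g1 <= e by exact/dvdn_leq/dvdn_gcdl.
  by move: qE ek; case: q => [|[|q]]; rewrite ?mul0n ?mul1n; nia.
elim=> [|n [g [g0 gle og]]]; first by exists g1; rewrite expn1.
have [i oi] := overlap_lift n.+1 o1.
have og' := overlap_gcd (overlapS og) oi.
rewrite /gcdz -PoszM absz_nat in og'.
set w := `|_|%N in og'; exists (gcdn (k * g) w).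
have kg0 : 0 < k * g by rewrite muln_gt0 k_gt0.
split; rewrite ?gcdn_gt0 ?kg0 //.
set g' := gcdn _ w.
have d1 : gcdn g' k %| g1.
  have dk : gcdn g' k %| k by exact: dvdn_gcdr.
  have dw : (Posz (gcdn g' k) %| (g1%:Z + k%:Z * i)%R)%Z.
    by rewrite dvdzE /=; apply: dvdn_trans (dvdn_gcdl _ _) (dvdn_gcdr _ _).
  by move: dw; rewrite rpredDr ?dvdz_mulr.
have d2 : g' %| gcdn g' k * g.
  by rewrite muln_gcdl dvdn_gcd dvdn_mulr //= dvdn_gcdl.
have gk0 : 0 < gcdn g' k by rewrite gcdn_gt0 k_gt0 orbT.
rewrite (leq_trans (dvdn_leq _ d2)) ?muln_gt0 ?gk0 //.
by rewrite expnS leq_mul // dvdn_leq.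
Qed.

(** Arbitrarily long agreement under shifts prime to the block structure would give overlaps
    [g <= (k / 2) ^ n] at level [n]. Two of the first [#|A| + 1] multiples of [g] would place the
    same block [phi^n(b)], up to [unforked], at two nearby positions: a period far shorter than the
    run of length [k ^ n] on which it holds, against [recurrent_mismatch]. *)
Lemma period_recognizable : no_class_period -> exists2 l, 0 < l &
  forall (t : int) x (i : int), ~~ (k%:Z %| t)%Z -> subshift phi x ->
    exists2 j, j < l & ~ unforked (x (i + j%:Z)%R) (x (i + j%:Z + t)%R).
Proof.
move=> bad; apply: contrapT => no.
pose Q e l := 0 < e /\ exists y y', [/\ subshift phi y, subshift phi y' &
  forall j : int, `|j|%N <= l ->
    unforked (inflate 1 0 y j) (inflate 1 e%:Z y' j)].
have [||e ek Qe] := @uniform_index k Q.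
- move=> r l l' ll' [r0 [y [y' [Xy Xy' E]]]]; split=> //.
  exists y, y'; split=> // j jl; apply: E; exact: leq_trans jl ll'.
- move=> l; apply: contrapT => noe; apply: no.
  exists (k + k * l + l).+1 => // t x i kt Xx.
  apply: contrapT => noj; apply: noe.
  have [r [z [rk Xz xE]]] :=
    desubstitute 1 (`|i|%N + (k + k * l + l).+1 + `|t|%N) Xx.
  have [q [s [sk iE]]] := pos_decomp 1 (i + r%:Z)%R.
  have [q' [e [ek tE]]] := pos_decomp 1 t; rewrite expn1 in sk iE ek tE.
  (* Recentring at this block puts all of [[-l, l]] inside the run of agreement that starts at
     [i]. *)
  pose c : int := (q + 1 + l%:Z)%R.
  exists e => //; split.
    rewrite lt0n; apply: contra kt => /eqP e0; rewrite tE e0 addr0.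
    by rewrite dvdz_mull.
  exists (shift_by c z), (shift_by (c + q')%R z).
  split; [exact/subshift_shift_by|exact/subshift_shift_by|move=> j jl].
  apply: contrapT => nu; apply: noj.
  have [u uE] : exists u : nat, (u%:Z = c * k%:Z + j - i - r%:Z)%R.
    exists `|(c * k%:Z + j - i - r%:Z)%R|%N; rewrite /c.
    by clear - jl iE sk; nia.
  exists u; first by move: uE; rewrite /c; clear - jl iE sk; nia.
  have uB : u <= (k + k * l + l).+1 by move: uE; rewrite /c; clear - jl iE sk;
    nia.
  rewrite !xE; [|by clear - uB; lia|by clear - uB; lia].
  rewrite !inflate_shift_by add0r !expn1 in nu => un; apply: nu.
  have E1 : inflate 1 (c * k%:Z)%R z j = inflate 1 r%:Z z (i + u%:Z)%R.
    by rewrite /inflate; have -> : (j + c * k%:Z = i + u%:Z + r%:Z)%R by lia.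
  have E2 : inflate 1 (e%:Z + (c + q') * k%:Z)%R z j =
      inflate 1 r%:Z z (i + u%:Z + t)%R.
    rewrite /inflate.
    by have -> : (j + (e%:Z + (c + q') * k%:Z) = i + u%:Z + t + r%:Z)%R by lia.
  by rewrite E1 E2.
have e0 : 0 < e by case: (Qe 0).
have oe : overlap 1 e%:Z%R by move=> l; case: (Qe l).
have [g1 kg1 G] := overlap_small e0 ek oe.
have [C C0 mis] := recurrent_mismatch bad.
have [y [_ [Xy _ _]]] := oe 0.
(* Large enough for [C * #|A| <= 2 ^ n], and [2 * g1 <= k] then bounds [C * #|A| * g] by [k ^ n]. *)
pose n := (C * #|A|).+1.
have [g [g0 gle og]] := G n.-1; rewrite /n /= -/n in gle og.
have Cg : C * (#|A| * g) <= k ^ n.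
  have CA : C * #|A| <= 2 ^ n by rewrite ltnW // ltnW // ltn_expl.
  rewrite mulnA (leq_trans (leq_mul CA gle)) // -expnMn leq_exp2r //.
have om m : overlap n (m * g)%N%:Z%R.
  elim: m => [|m IH]; last by rewrite mulSn PoszD; exact: overlapD.
  by move=> l; exists y, y; split=> // j _; exact: unforked_refl.
have /choice[Y YP] (m : 'I_#|A|.+1) : exists y', subshift phi y' /\
    forall j : int, `|j|%N <= #|A| * g + k ^ n ->
      unforked (inflate n 0 y j) (inflate n (m * g)%N%:Z y' j).
  by have [y' Xy' E] := overlap_all (#|A| * g + k ^ n) (om m) Xy; exists y'.
have YE (m : 'I_#|A|.+1) i : i < k ^ n ->
    unforked (inflate n 0 y (i%:Z - (m * g)%N%:Z)%R) (letter n i (Y m 0%R)).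
  move=> ik; have [_ /(_ (i%:Z - (m * g)%N%:Z)%R)] := YP m.
  rewrite (@inflateE n (m * g)%N%:Z%R (Y m) 0%R _ i) //;
    last by rewrite subrK mul0r add0r.
  apply; have : m * g <= #|A| * g by rewrite leq_mul2r -ltnS ltn_ord orbT.
  by lia.
have /injectivePn[m [m' mm' Em]] : ~~ injectiveb (fun m => Y m 0%R : A).
  by apply/negP => /injectiveP /leq_card; rewrite card_ord ltnn.
wlog lt : m m' mm' Em / m < m'.
  move=> H; have [/(H m m' mm' Em)//|h|h] := ltngtP m m'; last first.
    by move/val_inj/eqP: h; rewrite (negPf mm').
  by apply: (H m' m) => //; rewrite eq_sym.
have [|j jC] := mis ((m' - m) * g) (inflate n 0%R y) (- (m' * g)%N%:Z)%R _
    (subshift_inflate Xy).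
  by rewrite muln_gt0 subn_gt0 lt.
apply; have jk : j < k ^ n.
  rewrite (leq_trans jC) // (leq_trans _ Cg) // leq_mul2l leq_mul2r.
  by rewrite (leq_trans (leq_subr _ _)) ?orbT // -ltnS.
rewrite addrC; apply: unforked_trans (YE m' j jk) _; rewrite -Em.
apply: unforked_sym; have -> : (j%:Z - (m' * g)%N%:Z + ((m' - m) * g)%N%:Z =
  j%:Z - (m * g)%N%:Z)%R by rewrite mulnBl; have := ltnW lt; nia.
exact: YE.
Qed.

(** * Counting differences *)

Lemma sum_blocks m K (G : nat -> nat) :
  \sum_(i < m * K) G i = \sum_(i < m) \sum_(j < K) G (i * K + j).
Proof.
elim: m => [|m IH]; first by rewrite mul0n !big_ord0.
by rewrite mulSnr big_split_ord /= IH big_ord_recr.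
Qed.

Definition diff_count n c d := \sum_(i < k ^ n) (letter n i c != letter n i d).

Lemma diff_countS n c d : diff_count n.+1 c d =
  \sum_(i < k) diff_count n (letter 1 i c) (letter 1 i d).
Proof.
rewrite /diff_count expnS.
rewrite (sum_blocks k (k ^ n) (fun i => letter n.+1 i c != letter n.+1 i d)).
by apply: eq_bigr => i _; apply: eq_bigr => j _; rewrite -add1n !letterD.
Qed.

Definition pair_letter n i (v : A * A) := (letter n i v.1, letter n i v.2).

Definition reach_pair (v : A * A) : {set A * A} :=
  [set w | `[< exists n i, w = pair_letter n i v >]]%SET.

Lemma reach_pairP w v : w \in reach_pair v <-> exists n i,
  w = pair_letter n i v.
Proof. by rewrite finset.in_set; split => /asboolP. Qed.

Lemma pair_letter_comp n m i j v : pair_letter m j (pair_letter n i v) =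
  pair_letter (n + m) (i * k ^ m + j %% k ^ m) v.
Proof. by rewrite /pair_letter /= !letter_comp. Qed.

Lemma reach_pair_sub n i v : reach_pair (pair_letter n i v) \subset reach_pair
  v.
Proof.
apply/fintype.subsetP => w /reach_pairP[m [j ->]]; rewrite pair_letter_comp.
by apply/reach_pairP; exists (n + m), (i * k ^ m + j %% k ^ m).
Qed.

Definition pair_returns i v := v \in reach_pair (pair_letter 1 i v).

Lemma card_reach_pair_lt i v : ~~ pair_returns i v ->
  #|reach_pair (pair_letter 1 i v)| < #|reach_pair v|.
Proof.
move=> nr; apply/proper_card/properP; split; first exact: reach_pair_sub.
exists v => //; apply/reach_pairP; exists 0, 0; rewrite /pair_letter /=.
by case: (v).
Qed.

(** The argument of [return_uniq] for the singletons of [c] and [d]; here the leading digits [i] and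
    [i'] tell the two compositions apart. *)
Lemma pair_return_uniq i i' c d : c <> d -> unforked c d -> i < k -> i' < k ->
  pair_returns i (c, d) -> pair_returns i' (c, d) -> i = i'.
Proof.
move=> ne cd ik i'k.
have loop j : j < k -> pair_returns j (c, d) -> exists m u, [/\ u < k ^ m,
    letter (1 + m) (j * k ^ m + u) c = c & letter (1 + m) (j * k ^ m + u) d =
      d].
  move=> jk /reach_pairP[m [u]]; rewrite pair_letter_comp => E.
  exists m, (u %% k ^ m); rewrite ltn_mod; split => //.
    exact/esym/(congr1 fst E).
  exact/esym/(congr1 snd E).
move=> /(loop _ ik)[m [u [um uc ud]]] /(loop _ i'k)[m' [u' [um' uc' ud']]].
have [//|ii'] := eqVneq i i'; exfalso.
pose a := i * k ^ m + u; pose b := i' * k ^ m' + u'.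
have ak : a < k ^ (1 + m).
  by rewrite /a expnS; move: (k ^ m) um => K; clear - ik; nia.
have bk : b < k ^ (1 + m').
  by rewrite /b expnS; move: (k ^ m') um' => K; clear - i'k; nia.
pose M := 1 + m + (1 + m').
have E1 e : letter M (a * k ^ (1 + m') + b) e = letter (1 + m') b (letter (1 +
  m) a e).
  by rewrite letterD.
have E2 e : letter M (b * k ^ (1 + m) + a) e = letter (1 + m) a (letter (1 +
  m') b e).
  by rewrite /M addnC letterD.
have lt J K v w : v < J -> w < K -> v * K + w < J * K by clear; nia.
have lt1 : a * k ^ (1 + m') + b < k ^ M by rewrite [k ^ M]expnD; exact: lt.
have lt2 : b * k ^ (1 + m) + a < k ^ M.
  have -> : k ^ M = k ^ (1 + m') * k ^ (1 + m) by rewrite -expnD addnC.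
  exact: lt.
have high l K J v w : v < K -> w < J -> ((l * K + v) * J + w) %/ (K * J) = l.
  move=> vK wJ; rewrite mulnDl -mulnA -addnA divnMDl.
    by rewrite divn_small ?addn0 //; clear - vK wJ; nia.
  by rewrite muln_gt0 !(leq_trans _ vK, leq_trans _ wJ).
have high1 := high i _ _ _ _ um bk; have high2 := high i' _ _ _ _ um' ak.
apply: (@unforked_one_return M _ _ (fun e => e = c) (fun e =>
  e = d) c d lt1 lt2) cd => //.
- move=> E; move/negP: ii'; apply; apply/eqP.
  rewrite -high1 -/a E -high2 -/b -!expnD; congr (_ %/ k ^ _).
  by clear; lia.
- by move=> e ->; rewrite E1 uc uc'.
- by move=> e ->; rewrite E2 uc' uc.
- by move=> e ->; rewrite E1 ud ud'.
- by move=> e ->; rewrite E2 ud' ud.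
- by move=> e -> /ne.
Qed.

Lemma leq_sum_exceptional n (G : nat -> nat) (p : nat -> bool) B C :
  (forall i j, i < n -> j < n -> p i -> p j -> i = j) ->
  (forall i, i < n -> G i <= B) -> (forall i, i < n -> ~~ p i -> G i <= C) ->
  \sum_(i < n) G i <= B + n * C.
Proof.
move=> puniq GB GC; have [[i pi]|no] := pselect (exists i : 'I_n, p i).
  rewrite (bigD1 i) //= leq_add ?GB //.
  rewrite -[n in n * C]card_ord -sum_nat_const [leqRHS](bigD1 i) //=.
  rewrite (leq_trans _ (leq_addl _ _)) //; apply: leq_sum => j ji;
    apply: GC => //.
  by apply: contra ji => pj;
    apply/eqP/val_inj/(puniq _ _ (ltn_ord j) (ltn_ord i)).
rewrite (leq_trans _ (leq_addl _ _)) // -[n in n * C]card_ord -sum_nat_const.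
by apply: leq_sum => j _; apply: GC => //; apply/negP => pj; apply: no;
  exists j.
Qed.

(* At most one of the [k] children of an unforked pair leads back to it, so its
   number of differences obeys the recursion of a polynomial. *)
Lemma diff_count_poly n c d : unforked c d ->
  diff_count n c d <= (1 + k * n) ^ #|{: A * A}|.
Proof.
have : #|reach_pair (c, d)| <= #|{: A * A}| by exact: max_card.
elim: #|{: A * A}| n c d => [|r IHr] n c d.
  rewrite leqn0 cards_eq0 => /eqP E; suff : (c, d) \in reach_pair (c, d).
    by rewrite E finset.in_set0.
  by apply/reach_pairP; exists 0, 0.
(* The returning child is bounded by induction on [n], the others by induction on the number [r] of
   reachable pairs. *)
elim: n c d => [|n IHn] c d rc cd.
  by rewrite /diff_count big_ord1 muln0 exp1n leq_b1.
have [->|/eqP ne] := eqVneq c d.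
  by rewrite /diff_count big1 // => i _; rewrite eqxx.
rewrite diff_countS.
have sub i : #|reach_pair (letter 1 i c, letter 1 i d)| <= #|reach_pair (c, d)|.
  exact/subset_leq_card/(reach_pair_sub 1 i (c, d)).
apply: (@leq_trans ((1 + k * n) ^ r.+1 + k * (1 + k * n) ^ r)).
  apply: (@leq_sum_exceptional k (fun i =>
    diff_count n (letter 1 i c) (letter 1 i d))
    (fun i => pair_returns i (c, d))).
  - by move=> i j ik jk; exact: pair_return_uniq.
  - move=> i _; apply: IHn; last exact: unforked_letter.
    exact: leq_trans (sub i) rc.
  - move=> i _ nr; apply: IHr; last exact: unforked_letter.
    by rewrite -ltnS (leq_trans _ rc) //; exact: (card_reach_pair_lt nr).
rewrite expnS -mulnDl [leqRHS]expnS leq_mul //; first by rewrite mulnS; clear;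
  lia.
case: r {IHr IHn rc} => // r; rewrite leq_exp2r // leq_add2l leq_mul2l.
by rewrite leqnSn orbT.
Qed.

Lemma hits_inflate n r y y' (a : int) : (forall q, unforked (y q) (y' q)) ->
  hits (fun i => inflate n r y i != inflate n r y' i) a (k ^ n) <=
  2 * (1 + k * n) ^ #|{: A * A}|.
Proof.
move=> yy'; have [q [s [sk aE]]] := pos_decomp n (a + r)%R.
pose E i := inflate n r y i != inflate n r y' i.
have block p : hits E (p * (k ^ n)%:Z - r)%R (k ^ n) <= (1 + k * n) ^ #|{: A *
  A}|.
  apply: leq_trans (diff_count_poly n (yy' p)).
  rewrite /hits /diff_count leq_eqVlt; apply/orP; left; apply/eqP.
  apply: eq_bigr => j _; rewrite /E !(@inflateE n r _ p _ j) //.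
    by rewrite addrAC subrK.
  by rewrite addrAC subrK.
apply: (@leq_trans (hits E (q * (k ^ n)%:Z - r)%R (k ^ n + k ^ n))).
  by apply: hits_sub; clear - aE sk; lia.
rewrite hitsD mul2n -addnn leq_add ?block //.
have -> : (q * (k ^ n)%:Z - r + (k ^ n)%:Z = (q + 1) * (k ^ n)%:Z - r)%R by lia.
exact: block.
Qed.

Definition fork_count n c d :=
  \sum_(i < k ^ n) `[< ~ unforked (letter n i c) (letter n i d) >].

Lemma fork_countD m n c d q :
  (forall c' d', ~ unforked c' d' -> q <= fork_count n c' d') ->
  q * fork_count m c d <= fork_count (m + n) c d.
Proof.
move=> h; rewrite {2}/fork_count expnD.
rewrite (sum_blocks (k ^ m) (k ^ n)
  (fun i => `[< ~ unforked (letter (m + n) i c) (letter (m + n) i d) >])).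
rewrite big_distrr /=; apply: leq_sum => i _.
have [/h le|_] := asboolP (~ unforked (letter m i c) (letter m i d));
  last by rewrite muln0.
rewrite muln1 (leq_trans le) // leq_eqVlt; apply/orP; left; apply/eqP.
by apply: eq_bigr => j _; rewrite !letterD.
Qed.

Lemma not_unforked_of_letter n i c d :
  ~ unforked (letter n i c) (letter n i d) -> ~ unforked c d.
Proof. by move=> h cd; apply: h; exact: unforked_letter. Qed.

(** A forked pair reproduces itself at position [U] forever, hence occurs below level [n]; its
    ancestor at level [n] is not unforked. *)
Lemma fork_count_gt0 n c d : ~ unforked c d -> 0 < fork_count n c d.
Proof.
move=> /forked_not_unforked[m [i [ik fk]]].
have [ne [N [U [V [UV Vk gE idem [ga gb]]]]]] := fk.
have N0 : 0 < N by case: N Vk {gE idem ga gb} => //; rewrite expn0;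
  case: (V) UV.
have Uk := ltn_trans UV Vk.
pose M := m + N * n; have nM : n <= M by rewrite (leq_trans _ (leq_addl _ _))
  // leq_pmull.
pose w := i * k ^ (N * n) + centre N U n.
have wE e : letter N U (letter m i e) = letter m i e ->
  letter M w e = letter m i e.
  move=> ge; rewrite letterD ?centre_lt // letter_centreE //.
  by elim: (n) => //= u ->.
pose j := w %/ k ^ (M - n) %% k ^ n.
have jk : j < k ^ n by rewrite ltn_mod.
have nu : ~ unforked (letter n j c) (letter n j d).
  rewrite !letter_mod.
  apply: (@not_unforked_of_letter (M - n) (w %% k ^ (M - n))).
  have low e : letter (M - n) (w %% k ^ (M - n)) (letter n (w %/ k ^ (M - n)) e)
      = letter M w e.
    by rewrite -letterD ?ltn_mod // -divn_eq subnKC.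
  by rewrite !low !wE // => /(_ 0 0).
by rewrite /fork_count (bigD1 (Ordinal jk)) //= asboolT.
Qed.

Lemma fork_count_ge2 : exists2 n0, 0 < n0 &
  forall c d, ~ unforked c d -> 1 < fork_count n0 c d.
Proof.
have /choice[f fP] (t : A * A) : exists n, ~ unforked t.1 t.2 ->
    1 < fork_count n t.1 t.2.
  have [|nu] := pselect (unforked t.1 t.2); first by exists 0.
  have [m [i [ik fk]]] := forked_not_unforked nu.
  have [ne [N [U [V [UV Vk gE idem [ga gb]]]]]] := fk.
  have Uk := ltn_trans UV Vk; exists (m + N) => _.
  have jk W : W < k ^ N -> i * k ^ N + W < k ^ (m + N).
    by rewrite expnD; move: (k ^ m) (k ^ N) ik => K J; clear; nia.
  have nuW W : W < k ^ N -> letter N U =1 letter N W -> ~ unforked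
      (letter (m + N) (i * k ^ N + W) t.1) (letter (m + N) (i * k ^ N + W) t.2).
    by move=> Wk UW; rewrite !letterD // -!UW ga gb => /(_ 0 0).
  rewrite /fork_count (bigD1 (Ordinal (jk U Uk))) //=.
  rewrite (bigD1 (Ordinal (jk V Vk))) /=; last first.
    by rewrite -val_eqE /= eqn_add2l gtn_eqF.
  by rewrite !asboolT; [|exact: nuW|exact: nuW].
exists (\max_t f t).+1 => // c d nu.
have ft : f (c, d) <= (\max_t f t).+1.
  by rewrite leqW //; exact: (bigop.leq_bigmax (c, d)).
rewrite -(subnKC ft) (leq_trans (fP (c, d) nu)) //= -[leqLHS]mul1n.
by apply: fork_countD => c' d'; exact: fork_count_gt0.
Qed.

Lemma fork_count_expn : exists2 n0, 0 < n0 &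
  forall m c d, ~ unforked c d -> 2 ^ (m %/ n0) <= fork_count m c d.
Proof.
have [n0 n00 H] := fork_count_ge2; exists n0 => // m c d nu.
have Hn n c' d' : ~ unforked c' d' -> 2 ^ n <= fork_count (n * n0) c' d'.
  elim: n c' d' => [|n IH] c' d' nu'; first exact: fork_count_gt0.
  rewrite mulSn expnSr (leq_trans _ (fork_countD n0 c' d' IH)) //.
  by rewrite leq_mul2l H ?orbT.
rewrite [in fork_count _](divn_eq m n0) (leq_trans (Hn _ _ _ nu)) //.
by rewrite -[leqLHS]mul1n; apply: fork_countD => c' d'; exact: fork_count_gt0.
Qed.

(** After [n] desubstitutions the shift is by [t], prime to the block structure. Recognizability
    finds a pair that is not unforked within boundedly many blocks, and its [phi^n] images differ in
    [2 ^ (n %/ n0)] places. *)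
Lemma hits_forked : no_class_period -> exists n0 L, [/\ 0 < n0, 0 < L &
  forall n (t : int) x (a : int), ~~ (k%:Z %| t)%Z -> subshift phi x ->
    2 ^ (n %/ n0) <=
    hits (fun i => x i != x (i + t * (k ^ n)%:Z)%R) a (L * k ^ n)].
Proof.
move=> bad; have [n0 n00 H] := fork_count_expn.
have [l l0 rec] := period_recognizable bad.
exists n0, l.+1; split=> // n t x i kt Xx.
pose K := k ^ n.
have [r [y [rk Xy xE]]] :=
  desubstitute n (`|i|%N + l.+1 * K + `|t|%N * K) Xx.
have [q [s [sk iE]]] := pos_decomp n (i + r%:Z)%R.
have [j jl nu] := rec t y (q + 1)%R kt Xy.
pose i0 := ((q + 1 + j%:Z) * K%:Z - r%:Z)%R.
apply: leq_trans (H n _ _ nu) _.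
have jK : j * K + K <= l * K by rewrite addnC -mulSn leq_mul2r jl orbT.
apply: (@leq_trans (hits (fun i => x i != x (i + t * K%:Z)%R) i0 K));
  last first.
  by apply: hits_sub; move: iE sk jK; rewrite -/K /i0; clearbody K; clear; nia.
apply: leq_sum => u _; have uK : u < K by exact: ltn_ord.
case: asboolP => // nu'; rewrite lt0b; apply/eqP => e; apply: nu'.
have B1 : `|(i0 + u%:Z)%R|%N <= `|i|%N + l.+1 * K + `|t|%N * K.
  move: iE sk jK uK; rewrite /i0 /K; clear; move: (k ^ n) (u : nat) => K w.
  by nia.
have B2 : `|(i0 + u%:Z + t * K%:Z)%R|%N <= `|i|%N + l.+1 * K + `|t|%N * K.
  move: iE sk jK uK; rewrite /i0 /K; clear; move: (k ^ n) (u : nat) => K w.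
  by nia.
move: e; rewrite !xE //.
rewrite (@inflateE n _ _ (q + 1 + j%:Z)%R _ u) //; last first.
  by rewrite /i0 addrAC subrK.
rewrite (@inflateE n _ _ (q + 1 + j%:Z + t)%R _ u) // => [->|].
  exact: unforked_refl.
by rewrite /i0 -/K; clear; lia.
Qed.

(** * Amorphic complexity of the subshift *)

Lemma zpow_shift (l : int) (x : full_shift A) :
  zpow (@left_shift A) (@left_shift_inv A) l x = shift_by l x.
Proof.
apply/funext => i; rewrite /shift_by; case: l => n /=.
  elim: n i => [|n IH] i /=; first by rewrite addr0.
  by rewrite {1}/left_shift IH; congr x; lia.
have -> : (i + Negz n = i - 1 - n%:Z)%R by lia.
rewrite -[LHS]/(iter n (@left_shift_inv A) x (i - 1)%R).
elim: n (i - 1)%R => [|n IH] j /=; first by rewrite subr0.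
by rewrite {1}/left_shift_inv IH; congr x; lia.
Qed.

Section ShiftMetric.
Variables (R : realType) (beta : R).
Hypothesis hbeta : (1 < beta)%R.

Local Notation dist := (@shift_dist R beta A).
Local Notation separated := (ac_separated dist (@left_shift A)
  (@left_shift_inv A)).
Implicit Types (u v : full_shift A).

Lemma bernoulli (n : nat) (b : R) : (1 <= b)%R ->
  (1 + n%:R * (b - 1) <= b ^+ n)%R.
Proof.
move=> b1; elim: n => [|n IH]; first by rewrite mul0r addr0 expr0.
rewrite exprS -natr1.
have h : (b * (1 + n%:R * (b - 1)) <= b * b ^+ n)%R by rewrite ler_wpM2l //;
  lra.
apply: le_trans h.
have : (0 <= n%:R * (b - 1) * (b - 1) :> R)%R by rewrite !mulr_ge0 // subr_ge0.
by lra.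
Qed.

Lemma small_power (delta : R) : (0 < delta)%R ->
  exists m, (beta ^- m < delta)%R.
Proof.
move=> d0; pose m := (Num.truncn (delta^-1 / (beta - 1))).+1.
have b10 : (0 < beta - 1)%R by rewrite subr_gt0.
exists m; have := bernoulli m (ltW hbeta).
have : (delta^-1 / (beta - 1) < m%:R)%R by exact: truncnS_gt.
rewrite ltr_pdivrMr // => h1 h2.
have bm : (0 < beta ^+ m)%R by rewrite exprn_gt0 // (lt_trans ltr01).
rewrite -[ltRHS]invrK ltf_pV2 ?posrE ?invr_gt0 //.
by rewrite (lt_le_trans h1) // (le_trans _ h2) // lerDr.
Qed.

Lemma shift_dist_ge1 u v : u 0%R <> v 0%R -> (1 <= dist u v)%R.
Proof.
move=> ne; have d0 : differ_at u v 0 by rewrite /differ_at; move/eqP: ne => ->.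
rewrite /shift_dist; case: pselect => [ex|[]]; last by exists 0.
by case: ex_minnP => m _ /(_ 0 d0); rewrite leqn0 => /eqP ->;
  rewrite expr0 invr1.
Qed.

Lemma shift_dist_lt (delta : R) m u v : (beta ^- m < delta)%R ->
  (forall i : int, `|i|%N <= m -> u i = v i) -> (dist u v < delta)%R.
Proof.
move=> bm agree; have b0 : (0 < beta)%R by exact: lt_trans hbeta.
rewrite /shift_dist; case: pselect => [ex|_]; last first.
  by apply: lt_trans bm; rewrite invr_gt0 exprn_gt0.
case: ex_minnP => j dj _; apply: le_lt_trans bm.
have mj : m < j.
  rewrite ltnNge; apply/negP => jm; move: dj; rewrite /differ_at.
  by rewrite !agree ?eqxx //; lia.
rewrite lef_pV2 ?posrE ?exprn_gt0 // ler_eXn2l // ltnW //.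
Qed.

Lemma separated_of_hits (nu : R) q L u v : 0 < L ->
  (forall a : int, q <= hits (fun i => u i != v i) a L) ->
  (nu <= q%:R / (2 * L)%N%:R)%R -> separated 1%R nu u v.
Proof.
move=> L0 h nuq; rewrite /ac_separated.
apply: (@le_trans _ _ (q%:R / (2 * L)%N%:R)%:E); first by rewrite lee_fin.
apply: upper_density_ge => // a; apply: leq_trans (h a) _;
  apply: leq_hits => i ne.
apply/asboolP => /=; rewrite !zpow_shift; apply: shift_dist_ge1.
by rewrite /shift_by add0r; exact/eqP.
Qed.

(** Distance at least [delta] means a difference within [m] of the origin, so each difference is
    responsible for at most [2 m + 1] times. *)
Lemma not_separated_of_hits (delta nu : R) m q L u v : 0 < L ->
  (beta ^- m < delta)%R ->
  (forall a : int, hits (fun i => u i != v i) a L <= q) ->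
  ((2 * ((2 * m).+1 * q))%N%:R / L%:R < nu)%R -> ~ separated delta nu u v.
Proof.
move=> L0 bm h nuq; rewrite /ac_separated => le.
have : (((2 * ((2 * m).+1 * q))%N%:R / L%:R)%:E < nu%:E :> \bar R)%E by
  rewrite lte_fin.
apply/negP; rewrite -leNgt; apply: le_trans le _;
  apply: upper_density_le => // a.
apply: (@leq_trans (\sum_(j < (2 * m).+1)
    hits (fun i => u i != v i) (a - m%:Z + j%:Z)%R L)); last first.
  rewrite -[(2 * m).+1 in leqRHS]card_ord -sum_nat_const.
  by apply: leq_sum => j _; exact: h.
rewrite /hits exchange_big /=; apply: leq_sum => l _.
case: asboolP => //= D.
have [i im ne] : exists2 i : int, `|i|%N <= m &
    u (i + (a + l%:Z))%R <> v (i + (a + l%:Z))%R.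
  apply: contrapT => no; move: D; apply/negP; rewrite -ltNge !zpow_shift.
  apply: (shift_dist_lt bm) => i im; apply: contrapT => ne; apply: no.
  by exists i.
have jm : `|(i + m%:Z)%R|%N < (2 * m).+1 by lia.
rewrite (bigD1 (Ordinal jm)) //= (_ : (_ + _ + _)%R = (i + (a + l%:Z))%R).
  by move/eqP: ne => ->.
by lia.
Qed.

Local Notation X := (subshift phi : set (full_shift A)).
Local Notation T := (@left_shift A).
Local Notation T' := (@left_shift_inv A).

Lemma lower_ac_le_upper_ac : (lower_ac dist X T T' <= upper_ac dist X T T')%E.
Proof.
apply: ge_ereal_sup => _ [delta d0 <-]; apply: le_ereal_sup_tmp.
exists (limf_esup (ac_ratio dist X T T' delta) (0%R : R)^'+).
  by exists delta.
exact: einf_le_esup.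
Qed.

Lemma lower_ac_ge (K : nat) (B C : R) : 0 < K -> (1 < B)%R -> (0 < C)%R ->
  (forall N, ((K ^ N)%:R%:E <= Sep dist X T T' 1 ((C * B ^+ N)^-1))%E) ->
  ((ln K%:R / ln B)%:E <= lower_ac dist X T T')%E.
Proof.
move=> K0 B1 C0 H; apply: le_ereal_sup_tmp.
exists (limf_einf (ac_ratio dist X T T' 1) (0%R : R)^'+).
  by exists 1%R => //=.
exact: einf_ac_ratio_ge H.
Qed.

Lemma upper_ac_le (c : R) :
  (forall delta : R, (0 < delta)%R ->
     (limf_esup (ac_ratio dist X T T' delta) (0%R : R)^'+ <= c%:E)%E) ->
  (upper_ac dist X T T' <= c%:E)%E.
Proof. by move=> H; apply: ge_ereal_sup => _ [delta d0 <-]; exact: H. Qed.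

Lemma ac_finite : finite_set X -> ac_eq dist X T T' 0%E.
Proof.
move=> fX; pose H := #|` fset_set X|.+1.
have up : (upper_ac dist X T T' <= 0%:E)%E.
  apply: upper_ac_le => delta d0.
  have := @esup_ac_ratio_le R _ dist X T T' delta 1 H 2%R 1%R.
  rewrite ln1 mul0r; apply=> // [|N]; first by rewrite ltr1n.
  rewrite exp1n muln1; apply: ge_ereal_sup => _ [Z [ZX _] <-].
  have fZ : finite_set Z by exact: sub_finite_set fX.
  rewrite /counting asboolT // lee_fin ler_nat leqW //.
  by apply: fsubset_leq_card; rewrite -fset_set_sub.
have lo : (0%:E <= lower_ac dist X T T')%E.
  apply: le_ereal_sup_tmp.
  exists (limf_einf (ac_ratio dist X T T' 1) (0%R : R)^'+).
    by exists 1%R => //=.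
  apply: einf_right_ge => e e0; exists 1%R => // nu nu01.
  by apply: le_trans (ac_ratio_ge0 _ _ _ _ _ nu01);
    rewrite lee_fin sub0r oppr_le0 ltW.
by have lu := lower_ac_le_upper_ac; split; apply/eqP; rewrite eq_le ?lo ?up;
  rewrite ?(le_trans lu up) ?(le_trans lo lu).
Qed.

Lemma hits_shift_by (x : int -> A) (s t : int) (a : int) n :
  hits (fun i => shift_by s x i != shift_by t x i) a n =
  hits (fun i => x i != x (i + (t - s))%R) (a + s)%R n.
Proof.
by apply: eq_bigr => j _; rewrite /shift_by; congr (nat_of_bool (x _ != x _));
  lia.
Qed.

Lemma Sep_orbit_ge (x : int -> A) M (nu : R) : subshift phi x -> (0 < nu)%R ->
  (forall t : nat, 0 < t -> t < M -> exists q L, [/\ 0 < L,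
     forall a : int, q <= hits (fun i => x i != x (i + t%:Z)%R) a L
   & (nu <= q%:R / (2 * L)%N%:R)%R]) ->
  (M%:R%:E <= Sep dist X T T' 1 nu)%E.
Proof.
move=> Xx nu0 H.
have key (s t : nat) : s < t -> t < M -> exists q L, [/\ 0 < L,
     forall a : int, q <= hits (fun i =>
       shift_by s%:Z x i != shift_by t%:Z x i) a L
   & (nu <= q%:R / (2 * L)%N%:R)%R].
  move=> st tM; have [||q [L [L0 h nuq]]] := H (t - s).
  - by rewrite subn_gt0.
  - by rewrite (leq_ltn_trans _ tM) ?leq_subr.
  exists q, L; split=> // a; rewrite hits_shift_by.
  by have -> : (t%:Z - s%:Z = (t - s)%N%:Z)%R by lia.
have sym (s t : nat) q L : (forall a : int, q <= hits
    (fun i => shift_by s%:Z x i != shift_by t%:Z x i) a L) -> forall a : int,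
    q <= hits (fun i => shift_by t%:Z x i != shift_by s%:Z x i) a L.
  by move=> h a; apply: leq_trans (h a) _; apply: leq_hits => i; rewrite eq_sym.
have sep (s t : nat) : s < M -> t < M -> s <> t -> exists q L, [/\ 0 < L,
     forall a : int, q <= hits (fun i =>
       shift_by s%:Z x i != shift_by t%:Z x i) a L
   & (nu <= q%:R / (2 * L)%N%:R)%R].
  move=> sM tM; case: (ltngtP s t) => // st _; first exact: key.
  have [q [L [L0 h nuq]]] := key t s st sM; exists q, L; split => //.
  exact: sym.
apply: (@Sep_ge _ _ _ _ _ _ (fun i : nat => shift_by i%:Z x : full_shift A)).
  by move=> i _; apply/subshift_shift_by.
move=> i j iM jM ij; have [q [L [L0 h nuq]]] := sep i j iM jM ij; split.
  move=> e; have q0 : q = 0.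
    apply/eqP; rewrite -leqn0 (leq_trans (h 0%R)) // leqn0 /hits big1 // => l _.
    by rewrite (_ : shift_by i%:Z x = shift_by j%:Z x) ?eqxx.
  by move: nuq; rewrite q0 mul0r leNgt nu0.
exact: separated_of_hits nuq.
Qed.

Lemma lower_ac_ge1 : (forall p, 0 < p -> exists x (i : int),
    subshift phi x /\ x i <> x (i + p%:Z)%R) ->
  (1%:E <= lower_ac dist X T T')%E.
Proof.
move=> inf; have [C C0 mis] := @recurrent_mismatch (fun a b => a = b) inf.
have [x [_ [Xx _]]] := inf 1 isT.
have l2 : (0 < ln 2%R :> R)%R by rewrite ln_gt0 // ltr1n.
have -> : (1 : R)%R = (ln 2%N%:R / ln 2%R)%R by rewrite divff // gt_eqF.
apply: (@lower_ac_ge 2 _ (2 * C)%N%:R) => // [||N].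
- by rewrite ltr1n.
- by rewrite ltr0n muln_gt0.
have B0 : (0 < (2 * C)%N%:R * 2 ^+ N :> R)%R.
  by rewrite mulr_gt0 ?exprn_gt0 // ltr0n muln_gt0.
apply: (Sep_orbit_ge Xx); first by rewrite invr_gt0.
move=> t t0 tM; exists 1, (C * 2 ^ N); split.
- by rewrite muln_gt0 C0 expn_gt0.
- move=> a; have [j jC ne] := mis t x a t0 Xx.
  have jL : j < C * 2 ^ N by rewrite (leq_trans jC) // leq_mul2l ltnW ?orbT.
  by rewrite /hits (bigD1 (Ordinal jL)) //=; move/eqP: ne => ->.
- by rewrite mul1r mulnA [in leRHS]natrM natrX.
Qed.

(** Among [K ^ N] shifts of one point, two at distance [t = t' * k ^ n] with [k] not dividing [t']
    differ with density at least a constant times [2 ^ (n %/ n0) / k ^ n], hence times [B ^- N]. The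
    bound [ln K / ln B] exceeds 1 as [B = K / 2]. *)
Lemma lower_ac_gt1 : no_class_period ->
  exists2 c : R, (1 < c)%R & (c%:E <= lower_ac dist X T T')%E.
Proof.
move=> bad; have [n1 [L [n10 L0 H1]]] := hits_forked bad.
(* [n0 >= 2] gives [K >= 4], so that [B = K / 2] is greater than 1. *)
pose n0 := n1.+1.
have H n (t : int) x (a : int) : ~~ (k%:Z %| t)%Z -> subshift phi x ->
  2 ^ (n %/ n0) <=
    hits (fun i => x i != x (i + t * (k ^ n)%:Z)%R) a (L * k ^ n).
  move=> kt Xx; apply: leq_trans (H1 n t x a kt Xx).
  by rewrite leq_exp2l // leq_div2l.
have [x [_ [Xx _]]] := bad 1 isT.
pose K := k ^ n0; pose B : R := (K%:R / 2)%R.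
have K4 : 4 <= K.
  rewrite /K (@leq_trans (2 ^ n0)) ?leq_exp2r //.
  by rewrite -[4]/(2 ^ 2) leq_exp2l.
have B1 : (1 < B)%R by rewrite /B ltr_pdivlMr // mul1r ltr_nat ltnW.
have BK : (B < K%:R)%R.
  by rewrite /B ltr_pdivrMr // ltr_pMr ?ltr1n // ltr0n ltnW // ltnW // ltnW.
exists (ln K%:R / ln B)%R.
  have Bp : (0 < B)%R by exact: lt_trans B1.
  by rewrite ltr_pdivlMr ?ln_gt0 // mul1r ltr_ln ?posrE // (lt_trans Bp).
apply: (@lower_ac_ge K B (2 * L)%N%:R) => // [||N].
- by rewrite ltnW // ltnW // ltnW.
- by rewrite ltr0n muln_gt0.
have B0 : (0 < B)%R by exact: lt_trans B1.
apply: (Sep_orbit_ge Xx).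
  by rewrite invr_gt0 mulr_gt0 ?exprn_gt0 // ltr0n muln_gt0.
move=> t t0 tM.
have [n [t' [tE kt']]] : exists n t', t = t' * k ^ n /\ ~~ (k %| t').
  have ex : exists n, ~~ (k ^ n.+1 %| t).
    exists t; apply/negP => /(dvdn_leq t0); apply/negP; rewrite -ltnNge.
    by rewrite (ltn_trans (ltn_expl t hk)) // ltn_exp2l.
  case: (ex_minnP ex) => n kn minn.
  have kdn : k ^ n %| t.
    case: n kn minn => [|n] _ minn; first by rewrite expn0.
    by apply: contraT => /minn; rewrite ltnn.
  have [t' tE] := dvdnP kdn; exists n, t'; split => //.
  by apply: contra kn => kt'; rewrite tE expnS dvdn_mul.
have t'0 : 0 < t' by case: t' tE kt' => // _; rewrite dvdn0.
have nN : n < n0 * N.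
  rewrite -(@ltn_exp2l k) // expnM; apply: leq_ltn_trans tM.
  by rewrite tE leq_pmull.
exists (2 ^ (n %/ n0)), (L * k ^ n); split.
- by rewrite muln_gt0 L0 expn_gt0 ltnW.
- by move=> a; have := H n (Posz t') x a kt' Xx; rewrite tE PoszM.
have nat_le : k ^ n * 2 ^ N <= 2 ^ (n %/ n0) * K ^ N.
  have uE := divn_eq n n0; have vn : n %% n0 < n0 by rewrite ltn_mod.
  move: (n %/ n0) (n %% n0) uE vn => w v uE vn.
  have wN : w < N by rewrite -(@ltn_pmul2r n0) //; lia.
  have [m m0 mE] : exists2 m, 0 < m & n0 * N = n + m.
    by exists (n0 * N - n); rewrite ?subn_gt0 // subnKC // ltnW.
  have le : N <= w + m by clear - uE vn wN mE; nia.
  rewrite /K -expnM mE expnD mulnCA leq_mul2l; apply/orP; right.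
  rewrite (@leq_trans (2 ^ (w + m))) ?leq_exp2l //.
  by rewrite expnD leq_mul2l leq_exp2r // hk orbT.
have BN0 : (0 < (2 * L)%N%:R * B ^+ N :> R)%R.
  by rewrite mulr_gt0 ?exprn_gt0 // ltr0n muln_gt0.
have Lk0 : (0 < (2 * (L * k ^ n))%N%:R :> R)%R.
  by rewrite ltr0n !muln_gt0 L0 expk_gt0.
rewrite -[leLHS]mul1r ler_pdivrMr // mulrAC ler_pdivlMr // mul1r.
rewrite /B expr_div_n !mulrA ler_pdivlMr ?exprn_gt0 //.
rewrite -!natrX -!natrM ler_nat.
have -> : 2 * (L * k ^ n) * 2 ^ N = 2 * L * (k ^ n * 2 ^ N) by rewrite !mulnA.
have -> : 2 ^ (n %/ n0) * (2 * L) * K ^ N = 2 * L * (2 ^ (n %/ n0) * K ^ N).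
  by rewrite mulnAC mulnC.
by rewrite leq_mul2l nat_le orbT.
Qed.

Definition has_address N h (c : 'I_(k ^ N) * {ffun 'I_h -> A}) (x : int -> A) :=
  forall l, exists y, [/\ subshift phi y,
    forall i : int, `|i|%N <= l -> x i = inflate N (c.1 : nat)%:Z y i
  & forall j : 'I_h, y (j : nat)%:Z%R = c.2 j].

Lemma address_exists N h x : subshift phi x ->
  exists c : 'I_(k ^ N) * {ffun 'I_h -> A}, has_address c x.
Proof.
move=> Xx; apply: uniform_colour => [c l l' ll' [y [Xy xE yE]]|l].
  by exists y; split=> // i il; apply: xE; exact: leq_trans ll'.
have [r [y [rk Xy xE]]] := desubstitute N l Xx.
exists (Ordinal rk, [ffun j : 'I_h => y (j : nat)%:Z%R]), y; split => //= j.
by rewrite ffunE.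
Qed.

Lemma address_hits N h (c : 'I_(k ^ N) * {ffun 'I_h -> A}) x x' (a : int) :
  class_period h -> has_address c x -> has_address c x' ->
  hits (fun i => x i != x' i) a (k ^ N) <= 2 * (1 + k * N) ^ #|{: A * A}|.
Proof.
move=> hE /(_ (`|a|%N + k ^ N))[y [Xy xE yE]] /(_ (`|a|%N + k ^ N))[y' [Xy'
  x'E y'E]].
have [h0 _] := hE; have h0' : (Posz h != 0)%R by lia.
have yy' q : unforked (y q) (y' q).
  have jh : `|(q %% h%:Z)%Z|%N < h.
    by have := modz_ge0 q h0'; have := ltz_mod q h0'; lia.
  have dv : (h%:Z %| (q - `|(q %% h%:Z)%Z|%N%:Z)%R)%Z.
    apply/dvdzP; exists (q %/ h%:Z)%Z; have := divz_eq q h.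
    by have := modz_ge0 q h0'; lia.
  apply: unforked_trans (class_period_eqmod hE Xy' dv).
  apply: unforked_sym; have := class_period_eqmod hE Xy dv.
  by rewrite (yE (Ordinal jh)) (y'E (Ordinal jh)).
apply: leq_trans (hits_inflate N (c.1 : nat)%:Z%R a yy').
rewrite leq_eqVlt; apply/orP; left; apply/eqP; apply: eq_bigr => j _.
have ja : `|(a + j%:Z)%R|%N <= `|a|%N + k ^ N by have := ltn_ord j; lia.
by rewrite xE // x'E.
Qed.

Lemma upper_ac_le1 h : class_period h -> (upper_ac dist X T T' <= 1%:E)%E.
Proof.
move=> hE; apply: upper_ac_le => delta d0; apply/lee_addgt0Pr => e e0.
have [m bm] := small_power d0.
pose r := #|{: A * A}|.+1; pose lk : R := ln k%:R.
have lk0 : (0 < lk)%R by rewrite ln_gt0 // ltr1n.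
have e1 : (0 < 1 + e)%R by rewrite addr_gt0.
have r0 : (0 < r%:R :> R)%R by rewrite ltr0n.
(* Chosen so that [ln k / (ln k - r * eta) = 1 + e]. *)
pose eta := (e * lk / ((1 + e) * r%:R))%R.
have eta0 : (0 < eta)%R by rewrite !(mulr_gt0, invr_gt0).
have etaE : ((1 + e) * (r%:R * eta) = e * lk)%R.
  by rewrite /eta; field; rewrite !gt_eqF.
pose s := expR eta; have s1 : (1 < s)%R by rewrite /s -expR0 ltr_expR.
pose B := expR (lk - r%:R * eta).
have lB0 : (0 < lk - r%:R * eta)%R.
  by rewrite -(pmulr_rgt0 _ e1) mulrBr etaE mulrDl mul1r addrK.
have B1 : (1 < B)%R by rewrite /B -[ltLHS]expR0 ltr_expR.
(* With this constant Bernoulli's inequality for [s] dominates [1 + k * N]. *)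
pose C1 := (1 + k%:R / (s - 1))%R.
have s10 : (0 < s - 1)%R by rewrite subr_gt0.
have C10 : (0 < C1)%R by rewrite addr_gt0 // divr_gt0 // ltr0n ltnW.
have lin N : ((1 + k * N)%N%:R <= C1 * s ^+ N :> R)%R.
  apply: (@le_trans _ _ (C1 * (1 + N%:R * (s - 1)))%R); last first.
    by rewrite ler_wpM2l ?bernoulli // ltW.
  have -> : (C1 * (1 + N%:R * (s - 1)) =
      (1 + k * N)%N%:R + (N%:R * (s - 1) + k%:R / (s - 1)))%R.
    by rewrite natrD natrM /C1; field; rewrite gt_eqF.
  by rewrite lerDl addr_ge0 ?mulr_ge0 ?invr_ge0 ?ler0n ?(ltW s10).
have BE N : (B ^+ N * s ^+ (N * r) = k%:R ^+ N)%R.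
  rewrite mulnC exprM -exprMn_comm; last exact: mulrC.
  rewrite /B /s -expRM_natl -expRD.
  by rewrite subrK lnK // posrE ltr0n ltnW.
(* One 2 comes from the density bound, [2 m + 1] from the metric, the other 2 from a window meeting
   two blocks. *)
pose Cm : R := (2 * ((2 * m).+1 * 2))%N%:R%R.
pose C := (Cm * C1 ^+ r + 1)%R.
have C0 : (0 < C)%R by rewrite addr_gt0 // mulr_gt0 ?exprn_gt0 // /Cm ltr0n.
pose H := (#|{ffun 'I_h -> A}|).+1.
apply: (@le_trans _ _ (ln k%:R / ln B)%:E); last first.
  rewrite -EFinD lee_fin /B expRK ler_pdivrMr // -/lk.
  by rewrite mulrBr etaE mulrDl mul1r addrK.
have k0 : 0 < k by exact: ltnW.
apply: (@esup_ac_ratio_le _ _ _ _ _ _ _ k H B C) => // N.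
have /choice[col colP] (x : full_shift A) :
    exists c : 'I_(k ^ N) * {ffun 'I_h -> A}, subshift phi x -> has_address c x.
  have [Xx|nX] := pselect (subshift phi x).
    by have [c cP] := address_exists N h Xx; exists c.
  by exists (Ordinal (expk_gt0 N), [ffun=> x 0%R]).
apply: (@le_trans _ _ (#|{: 'I_(k ^ N) * {ffun 'I_h -> A}}|)%:R%:E); last first.
  by rewrite lee_fin ler_nat card_prod card_ord mulnC leq_mul2r leqnSn orbT.
apply: (@Sep_le _ _ _ _ _ _ _ col) => x y Xx Xy cE.
apply: (@not_separated_of_hits delta _ m (2 * (1 + k * N) ^ #|{: A * A}|) (k ^
  N)) => //.
  by move=> a; apply: address_hits (colP x Xx) _; rewrite // cE; exact: colP.
have kN0 : (0 < (k ^ N)%N%:R :> R)%R by rewrite ltr0n.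
have BN0 : (0 < B ^+ N)%R by rewrite exprn_gt0 // (lt_trans ltr01).
rewrite ltr_pdivrMr // mulrAC ltr_pdivlMr // natrX -BE.
rewrite [(C * _)%R]mulrCA [ltRHS]mulrC ltr_pM2r //.
rewrite !mulnA natrM -!mulnA -/Cm.
have sN1 : (1 <= s ^+ (N * r))%R by rewrite exprn_ege1 // ltW.
apply: (@le_lt_trans _ _ (Cm * C1 ^+ r * s ^+ (N * r))%R); last first.
  by rewrite ltr_pM2r ?(lt_le_trans ltr01) // ltrDl.
rewrite -mulrA ler_wpM2l ?ler0n // exprM -exprMn.
apply: (@le_trans _ _ ((1 + k * N)%N%:R ^+ r)%R).
  by rewrite -natrX ler_nat leq_pexp2l.
by rewrite lerXn2r ?nnegrE ?ler0n // mulr_ge0 ?exprn_ge0 // ltW // (lt_trans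
  ltr01).
Qed.

End ShiftMetric.

Local Notation X := (subshift phi : set (full_shift A)).
Local Notation T := (@left_shift A).
Local Notation T' := (@left_shift_inv A).

(** * Nullness and tameness *)

Lemma class_period_dichotomy : (exists h, class_period h) \/ no_class_period.
Proof.
have [|no] := pselect (exists h, class_period h); first by left.
right=> h h0; apply: contrapT => nox; apply: no; exists h; split=> // x i Xx.
by apply: contrapT => nu; apply: nox; exists x, i.
Qed.

(** A period common to all points would let [p] letters determine each of them. *)
Lemma infinite_aperiodic : infinite_set X -> forall p, 0 < p ->
  exists x (i : int), subshift phi x /\ x i <> x (i + p%:Z)%R.
Proof.
move=> inf p p0; apply: contrapT => no; apply: inf.
have per x (i : int) : subshift phi x -> x (i + p%:Z)%R = x i.
  by move=> Xx; apply: contrapT => ne; apply: no; exists x, i;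
    split => // /esym.
have perM x (i q : int) : subshift phi x -> x (i + q * p%:Z)%R = x i.
  move=> Xx; have nat j (n : nat) : x (j + n%:Z * p%:Z)%R = x j.
    elim: n => [|n IH]; first by rewrite mul0r addr0.
    by rewrite -[RHS]IH -[RHS]per //; congr x; lia.
  have [q0|q0] := lerP 0%R q.
    by rewrite -[RHS](nat i `|q|%N); congr x; lia.
  by rewrite -[LHS](nat _ `|q|%N); congr x; nia.
pose col (x : full_shift A) := [ffun j : 'I_p => x (j : nat)%:Z%R].
apply: contrapT => inf;
  have [B BX] := infinite_set_fset #|{ffun 'I_p -> A}|.+1 inf.
rewrite ltnNge => /negP; apply; rewrite cardE -(size_map col).
apply: uniq_leq_size => [|c _]; last by rewrite mem_enum.
rewrite map_inj_in_uniq ?fset_uniq // => x y xB yB /ffunP E.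
have [Xx Xy] : X x /\ X y by split; apply: BX.
apply/funext => i; have p0' : (Posz p != 0)%R by lia.
have jp : `|(i %% p%:Z)%Z|%N < p.
  by have := modz_ge0 i p0'; have := ltz_mod i p0'; lia.
have := E (Ordinal jp); rewrite !ffunE /=.
have -> : (`|(i %% p%:Z)%Z|%N%:Z = i + (- (i %/ p%:Z)%Z) * p%:Z)%R.
  by have := divz_eq i p%:Z; have := modz_ge0 i p0'; lia.
by rewrite !perM.
Qed.

Lemma nbhs_cylinder (x : full_shift A) (U : set (full_shift A)) : nbhs x U ->
  exists n : nat, forall y : full_shift A,
    (forall i : int, `|i|%N <= n -> y i = x i) -> U y.
Proof.
move=> xU; apply: contrapT => no.
have /choice[y yP] (n : nat) : exists y : full_shift A,
    (forall i : int, `|i|%N <= n -> y i = x i) /\ ~ U y.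
  apply: contrapT => noy; apply: no; exists n => y yx.
  by apply: contrapT => nUy; apply: noy; exists y.
have yx : y @ \oo --> x.
  apply/cvg_sup => i.
  have surj : range (fun u : full_shift A => u i) = [set: discrete_topology A].
    rewrite -subTset => b _.
    by exists (fun j : int => if j == i then b else x j) => //=; rewrite eqxx.
  apply/(@cvg_image _ _ _ _ _ _ surj) => W /nbhs_singleton Wx.
  exists ((fun u : full_shift A => u i) @^-1` W); last exact: image_preimage.
  by exists `|i|%N => // n /= tn; have [-> //] := yP n.
have [N _ NU] := yx U xU.
by have [_ nUy] := yP N; apply: nUy; apply: NU => /=.
Qed.

Lemma cylinder_nbhs (x : full_shift A) (i : int) :
  nbhs x [set y : full_shift A | y i = x i].
Proof.
have := @proj_continuous int (fun=> discrete_topology A) i x [set x i].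
by apply; exact: (@discrete_set1 (discrete_topology A)).
Qed.

Lemma null_tame : null X T T' -> tame X T T'.
Proof.
move=> nul x0 x1 [X0 X1 IT]; apply: nul;
  split=> // U0 U1 /IT H /H[S infS indS] n.
have [B BS Bn] := infinite_set_fset n infS.
by exists B => // G s fG GB; apply: indS => // i /GB /BS.
Qed.

(** For cylinders at a coordinate [i0] where the two points differ, an independence set translated
    by [i0] is shattered by two disjoint singletons. *)
Lemma class_period_null h : class_period h -> null X T T'.
Proof.
move=> hE x0 x1 [X0 X1 IN]; apply/funext => i0; apply: contrapT => ne.
pose P : {set A} * {set A} := ([set x0 i0]%SET, [set x1 i0]%SET).
have dis : disjoint_pair P.
  by move=> a; rewrite !finset.in_set1 => /eqP -> /eqP.
have [M HM] := shattered_bounded hE dis.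
have [S MS ind] := IN _ _ (cylinder_nbhs x0 i0) (cylinder_nbhs x1 i0) M.+1.
pose S' := [seq (i0 + i)%R | i <- enum_fset S].
have uS' : uniq S' by rewrite map_inj_uniq ?fset_uniq //; exact: addrI.
suff : size S' <= M by rewrite size_map leqNgt MS.
apply: HM => // s.
have [|x [Xx xG]] := ind [set` S] (fun i => s (i0 + i)%R) _ (fun i => id).
  exact: finite_fset.
exists x; split=> // _ /mapP[i iS ->]; have := xG i iS; rewrite /= zpow_shift.
by rewrite /shift_by; case: (s _) => /= ->; rewrite finset.in_set1.
Qed.

Lemma no_class_period_not_tame : no_class_period -> ~ tame X T T'.
Proof.
move=> /forked_independent_points[x0 [x1 [X0 X1 ne H]]] tam; apply: ne.
suff -> : x0 = x1 by [].
apply: (tam x0 x1); split=> // U0 U1 /nbhs_cylinder[n0 U0n] /nbhs_cylinder[n1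
  U1n].
have [f finj fP] := H (maxn n0 n1); exists (range f).
  move=> fin; apply: infinite_nat.
  have -> : [set: nat] = f @^-1` range f by apply/seteqP; split => // n _;
    exists n.
  by apply: finite_preimage fin => n m _ _; exact: finj.
move=> G s fG GS.
have fG' : finite_set (f @^-1` G) by apply: finite_preimage fG => n m _ _;
  exact: finj.
pose m := (\max_(l <- enum_fset (fset_set (f @^-1` G))) l).+1.
have [x Xx xE] := fP (s \o f) m; exists x; split=> // i Gi.
have [l _ li] := GS i Gi; rewrite /= zpow_shift -li /=.
have lm : l < m.
  rewrite ltnS; apply: (@bigop.leq_bigmax_seq _ _ predT id) => //.
  by rewrite in_fset_set // inE /= li.
have xl := xE l _ lm; move: xl => /=; case: (s (f l)) => xl.
  apply: U1n => j jn; rewrite /shift_by addrC xl // (leq_trans jn) //.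
  exact: leq_maxr.
apply: U0n => j jn; rewrite /shift_by addrC xl // (leq_trans jn) //.
exact: leq_maxl.
Qed.

End ConstantLength.

Local Open Scope ring_scope.

Theorem theorem1 (R : realType) (beta : R) (A : finType) (phi : A -> seq A)
    (k : nat) (hbeta : 1 < beta) (hk : (2 <= k)%N)
    (hlen : constant_length phi k) (hprim : primitive phi) :
  let X := subshift phi in
  let T := @left_shift A in
  let T' := @left_shift_inv A in
  let ac_is := ac_eq (@shift_dist R beta A) X T T' in
  [/\ (ac_is 0%E \/ ac_is 1%E) <-> null X T T',
      null X T T' <-> tame X T T'
    & ac_is 0%E <-> finite_set X].
Proof.
move=> X T T' ac_is.
have lu : (lower_ac (@shift_dist R beta A) X T T' <=
    upper_ac (@shift_dist R beta A) X T T')%E by apply: lower_ac_le_upper_ac.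
have lo1 : infinite_set X -> (1%:E <= lower_ac (@shift_dist R beta A) X T T')%E.
  by move=> inf; apply: (lower_ac_ge1 hk hlen hprim hbeta);
    apply: infinite_aperiodic.
have ac0 : finite_set X -> ac_is 0%E by exact: ac_finite.
have ac0_fin : ac_is 0%E -> finite_set X.
  move=> [l0 _]; apply: contrapT => /lo1; rewrite -/X -/T -/T' l0 lee_fin.
  by rewrite leNgt ltr01.
have [[h hE]|bad] : (exists h, class_period phi k h) \/ no_class_period phi k.
  by apply: class_period_dichotomy.
  have nul := class_period_null hk hlen hprim hE.
  split; [split => // _|split => // _; exact: null_tame|by split].
  have [/ac0|/lo1 lo] := pselect (finite_set X); first by left.
  right; have up := upper_ac_le1 hk hlen hprim hbeta hE.
  by split; apply/eqP; rewrite eq_le ?lo ?up ?(le_trans lu up) ?(le_trans lo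
    lu).
have nt := no_class_period_not_tame hk hlen hprim bad.
have [c c1 lc] := lower_ac_gt1 hk hlen hprim hbeta bad.
split; last by split.
- split=> [|/null_tame/nt //]; case=> -[l _]; move: lc;
  rewrite -/X -/T -/T' l lee_fin.
    by move=> /(lt_le_trans c1); rewrite ltNge ler01.
  by move=> /(lt_le_trans c1); rewrite ltxx.
- by split=> [/null_tame/nt|/nt].
Qed.
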